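(* For every $K\in\{2,3,\dots\}$ and every $r\in[1,\infty)$, the function $\min(r+1,K)^{1/r}M_{r,K}$ on $[0,1]^K$ is a precise merging function.
   Context: For $r\in[1,\infty)$, $M_{r,K}(p_1,\dots,p_K):=\left(\frac{p_1^r+\dots+p_K^r}{K}\right)^{1/r}$ on $[0,1]^K$. Fix an atomless probability space and let $\mathcal{U}$ be the set of all random variables on it uniformly distributed on $[0,1]$. A merging function is a Borel function $F:[0,1]^K\to[0,\infty)$, increasing (in the weak sense) in each argument, such that for each $\epsilon\in(0,1)$, $\sup\{\mathbb{P}(F(U_1,\dots,U_K)\le\epsilon)\mid U_1,\dots,U_K\in\mathcal{U}\}\le\epsilon$. It is precise if this supremum equals $\epsilon$ for each $\epsilon\in(0,1)$. *)

(* Defs.v *)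
From HB Require Import structures.
From mathcomp Require Import all_boot all_order all_algebra.
From mathcomp Require Import all_classical all_reals all_analysis.

Set Implicit Arguments.
Unset Strict Implicit.
Unset Printing Implicit Defensive.

Import Order.TTheory GRing.Theory Num.Theory.
Import numFieldNormedType.Exports.

Local Open Scope classical_set_scope.
Local Open Scope ring_scope.

Definition atomless (R : realType) (d : measure_display)
    (T : measurableType d) (P : probability T R) : Prop :=
  forall A : set T, measurable A -> (0 < P A)%E ->
    exists B : set T,
      [/\ measurable B, B `<=` A, (0 < P B)%E & (P B < P A)%E].

(* Values are required to lie in [0,1] everywhere, not just almost surely, so
   that functions defined on [0,1]^K can be composed with such variables.  The
   law is compared on measurable sets only: [uniform_prob] is an integral,
   which carries no meaning on other sets. *)
Definition uniform01 (R : realType) (d : measure_display)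
    (T : measurableType d) (P : probability T R) (U : {RV P >-> R}) : Prop :=
  (forall w, 0 <= U w <= 1) /\
  (forall A : set R, measurable A ->
     distribution P U A = uniform_prob (@ltr01 R) A).

Definition cube (R : realType) (K : nat) : set (K.-tuple R) :=
  [set p | forall i, 0 <= tnth p i <= 1].

(* A function on [0,1]^K is encoded as a total function on K-tuples of which
   only the restriction to [cube R K] is ever used.  The sigma-algebra on
   K-tuples is the product one, i.e. the Borel sigma-algebra of R^K. *)
Definition sup_prob_le (R : realType) (d : measure_display)
    (T : measurableType d) (P : probability T R) (K : nat)
    (F : K.-tuple R -> R) (eps : R) : \bar R :=
  ereal_sup
    [set P [set w | F [tuple (U i : T -> R) w | i < K] <= eps]
      | U in [set U : 'I_K -> {RV P >-> R} | forall i, uniform01 (U i)]].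

Definition increasing_each (R : realType) (K : nat)
    (F : K.-tuple R -> R) : Prop :=
  forall (i : 'I_K) (p q : K.-tuple R), cube p -> cube q ->
    (forall j, j != i -> tnth p j = tnth q j) ->
    tnth p i <= tnth q i -> F p <= F q.

Definition merging_function (R : realType) (d : measure_display)
    (T : measurableType d) (P : probability T R) (K : nat)
    (F : K.-tuple R -> R) : Prop :=
  [/\ measurable_fun (@cube R K) F,
      (forall p, cube p -> 0 <= F p),
      increasing_each F &
      forall eps : R, 0 < eps < 1 -> (sup_prob_le P F eps <= eps%:E)%E].

Definition precise_merging_function (R : realType) (d : measure_display)
    (T : measurableType d) (P : probability T R) (K : nat)
    (F : K.-tuple R -> R) : Prop :=
  merging_function P F /\
  (forall eps : R, 0 < eps < 1 -> sup_prob_le P F eps = eps%:E).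

Definition power_mean (R : realType) (r : R) (K : nat) (p : K.-tuple R) : R :=
  ((\sum_(i < K) tnth p i `^ r) / K%:R) `^ r^-1.

(* Main.v *)
Require Import Defs.
From HB Require Import structures.
From mathcomp Require Import all_boot all_order all_algebra.
From mathcomp Require Import all_classical all_reals all_analysis.
From mathcomp Require Import measurable_realfun.
From mathcomp Require Import zify ring lra.

Set Implicit Arguments.
Unset Strict Implicit.
Unset Printing Implicit Defensive.

Import Order.TTheory GRing.Theory Num.Theory.
Import numFieldNormedType.Exports.

Local Open Scope classical_set_scope.
Local Open Scope ring_scope.

(** Write c for min (r + 1, K).  The event that the scaled mean of U_1, ..., U_K
    is at most eps is the event that c * (U_1^r + ... + U_K^r) is at most
    K * eps^r, so the theorem has two halves: this event never has probability
    above eps ([power_sum_tail], which matters when c = r + 1), and it may have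
    probability arbitrarily close to eps ([coupling_power_sum]).

    _Upper bound._  If c = K, the event is contained in [U_1 <= eps].  If
    c = r + 1, it forces the sum of the (1 - (U_i / eps)^r)^+ to be at least
    K * r / (r + 1), while each of these terms has expectation
    eps * r / (r + 1); Markov's inequality gives eps.  Instead of integrating,
    the proof counts which thresholds eps * (k / N)^(1/r) the variables stay
    below, so that only the distribution functions of the U_i intervene.

    _Lower bound._  Fix a < eps and let rho = min (r, K - 1), so that
    c = rho + 1.  A variable distributed uniformly on [0, a] has a rho-th power
    of mean a^rho / c.  Choose an event of probability a on which all the U_i are
    at most a.  If the sum of the (U_i / a)^rho can be made nearly constant
    on it, this constant is about K / c, and the sum of the (U_i / a)^r is no
    larger because rho <= r, which is what the event asks for.  Cut [0, a] into
    N cells whose end points have equally spaced rho-th powers.  The index of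
    the cell of a uniform variable then has a law p on {0, ..., N - 1} which is
    nonincreasing ([cell_bound_concave]) and of mean at most N / c
    ([cell_bound_mean]).  Everything reduces to a discrete statement: if p is
    nonincreasing on {0, ..., n}, K * mean p <= c' and n <= c', then K copies
    of p have a coupling whose sum never exceeds c' ([mixing_coordinates]).
    The condition n <= c' is where rho <= K - 1 enters.

    _The mixing theorem._  Let q be the point nearest to K p in the convex hull
    of the count vectors of the K-tuples of sum at most c', and phi = K p - q.
    Every tuple T that carries mass in q maximises the sum of the phi (T i)
    among admissible tuples.  Suppose phi is not zero, and consider the set E of
    the positions x at which the slope phi (x + 1) - phi x takes its maximal
    value g, which is positive because otherwise the zero tuple would be the
    best one.  In an optimal tuple a coordinate standing in E may go up while
    another one goes down, and then optimality is preserved and the step down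
    also crosses a place of E.  Iterating this exchange shows that the total
    length of the runs of E above the coordinates of T is at most that of the
    runs below them ([optimal_rooms]), except when T spends the whole budget
    on the run of E that starts at 0; there phi is affine, and a comparison of
    means is contradictory.  Averaging over T, the runs above and the runs below
    compare in the same way under q.  But p is nonincreasing, hence q strictly decreases along E,
    which gives the opposite strict inequality ([sum_rooms]).

    _Realisation._  In an atomless space the values of P on the subsets of a
    measurable set fill an interval, so any finite law is the law of a
    random element Y ([atomless_discrete_law]), and a uniform variable can be
    built that runs through the classes of Y in order
    ([atomless_uniform_refining]). *)

(** * Nearest point of a convex hull *)

(** First-order condition: s is minus half the derivative at 0 of a function of
    t that is minimal at 0. *)
Lemma small_step_le0 (R : realFieldType) (s N : R) : 0 <= N ->
  (forall t, 0 < t <= 1 -> 0 <= t ^+ 2 * N - (t * s) *+ 2) -> s <= 0.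
Proof.
move=> N0 H; rewrite leNgt; apply/negP => s0.
have d0 : 0 < s + N + 1 by lra.
pose t := s / (s + N + 1).
have t0 : 0 < t by rewrite divr_gt0.
have t1 : t <= 1 by rewrite ler_pdivrMr //; lra.
have := H t; rewrite t0 t1 => /(_ isT); apply/negP; rewrite -ltNge.
have tN : t * N < s.
  rewrite /t mulrAC ltr_pdivrMr //.
  by rewrite ltr_pM2l //; lra.
have -> : t ^+ 2 * N - (t * s) *+ 2 = t * (t * N - s *+ 2) by rewrite mulr2n; ring.
by rewrite pmulr_rlt0 //; lra.
Qed.

(** The hull of the points v i, i in D, is compact, hence contains a point
    nearest to p.  A small step from it towards v i does not bring it closer to
    p, which says that the angle between p and v i seen from it is not acute. *)
Lemma closest_convex_combination (R : realType) (I J : finType)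
    (D : pred I) (v : I -> J -> R) (p : J -> R) : (exists i, D i) ->
  exists w : I -> R,
    [/\ forall i, 0 <= w i, forall i, ~~ D i -> w i = 0, \sum_i w i = 1 &
        forall i, D i -> \sum_j (p j - \sum_k w k * v k j)
                         * (v i j - \sum_k w k * v k j) <= 0].
Proof.
move=> [i0 Di0]; pose m := #|I|.
pose W (u : 'rV[R]_m) (i : I) := u ord0 (enum_rank i).
pose q u j := \sum_k W u k * v k j.
pose f u := \sum_j (p j - q u j) ^+ 2.
pose A := [set u : 'rV[R]_m | forall i, `[0, (D (enum_val i))%:R]%classic (u ord0 i)] `&`
          [set u | \sum_i W u i = 1].
have Wc i : continuous (fun u => W u i) by move=> u; exact: coord_continuous.
have Sc (L : finType) (F : L -> 'rV[R]_m -> R) : (forall i, continuous (F i)) ->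
    continuous (fun u => \sum_i F i u).
  move=> Fc; apply: continuous_big => // x.
  exact: (@add_continuous R).
have cA : compact A.
  apply: compact_closedI; first exact: (rV_compact (fun i => @segment_compact R 0 (D (enum_val i))%:R)).
  apply: (@preimage_closed _ _ (fun u => \sum_i W u i) [set 1]).
    by move=> u _; apply: (Sc _ (fun i u => W u i)).
  exact: closed_eq.
have A0 : A !=set0.
  exists (\row_j (j == enum_rank i0)%:R); split => [i|].
    rewrite /= mxE in_itv /= ler0n ler_nat; case: eqP => [->|//].
    by rewrite enum_rankK Di0.
  rewrite /= (bigD1 i0) //= big1 ?addr0 /W ?mxE ?eqxx // => i ii0.
  by rewrite mxE (inj_eq enum_rank_inj) (negbTE ii0).
have fc : continuous f.
  apply: (Sc _ (fun j u => (p j - q u j) ^+ 2)) => j u.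
  apply: (@continuous_comp _ _ _ (fun u => p j - q u j) (fun x : R => x ^+ 2));
    last exact: exprn_continuous.
  have qc : continuous (fun u => q u j).
    apply: (Sc _ (fun k u => W u k * v k j)) => k x.
    apply: (@continuousM _ _ (fun u => W u k) (fun=> v k j)); first exact: Wc.
    exact: cst_continuous.
  apply: (@continuousB _ R^o _ (fun=> p j) (fun u => q u j)); last exact: qc.
  exact: cst_continuous.
have [u /set_mem [u01 u1] umin] := EVT_min_rV A0 cA (continuous_subspaceT fc).
have u0 i : 0 <= W u i by have := u01 (enum_rank i); rewrite /= in_itv /= => /andP[].
exists (W u); split => // i Di.
  have := u01 (enum_rank i); rewrite /= in_itv /= enum_rankK (negPf Di) => h.
  by apply/eqP; rewrite eq_le andbC.
apply: (@small_step_le0 _ _ (\sum_j (v i j - q u j) ^+ 2)).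
  by apply: sumr_ge0 => j _; exact: sqr_ge0.
move=> t /andP[t0 t1].
(* The point at time t on the segment from the minimiser to the i-th vertex. *)
pose ut : 'rV[R]_m := \row_k ((1 - t) * u ord0 k + t * (k == enum_rank i)%:R).
have Wut k : W ut k = (1 - t) * W u k + t * (k == i)%:R.
  by rewrite /W mxE (inj_eq enum_rank_inj).
have delta (F : I -> R) : \sum_k (k == i)%:R * F k = F i.
  rewrite (bigD1 i) //= eqxx mul1r big1 ?addr0 // => k /negPf ->.
  by rewrite mul0r.
have qut j : q ut j = q u j + t * (v i j - q u j).
  rewrite /q; under eq_bigr do rewrite Wut mulrDl -!mulrA.
  by rewrite big_split /= -!mulr_sumr delta; ring.
have Aut : ut \in A.
  apply/mem_set; split => [k|].
    have := u01 k; rewrite /= !in_itv /= mxE => /andP[x0 x1].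
    case: eqP => [kE|_]; last first.
      by rewrite mulr0 addr0; rewrite mulr_ge0 ?subr_ge0 // (le_trans _ x1) // mulrBl mul1r gerBl mulr_ge0 // ltW.
    move: x0 x1; rewrite kE enum_rankK Di /= => x0 x1; rewrite mulr1.
    by apply/andP; split; nra.
  rewrite /=; under eq_bigr do rewrite Wut -[_%:R]mulr1.
  by rewrite big_split /= -!mulr_sumr u1 delta; ring.
have := umin _ Aut; rewrite -subr_ge0 /f -sumrB => /le_trans; apply.
rewrite mulr_sumr mulr_sumr -sumrMnl -sumrB ler_sum // => j _.
by rewrite qut -/(q u j) le_eqVlt; apply/orP; left; apply/eqP; ring.
Qed.

(** * Runs of a set of integers *)

Definition run (E : pred nat) (u v : nat) : bool := all E (iota u (v - u)).

Lemma run_first (E : pred nat) u v : (u < v)%N -> run E u v = E u && run E u.+1 v.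
Proof. by move=> uv; rewrite /run -(subnSK uv). Qed.

Lemma run_last (E : pred nat) u v : (u <= v)%N -> run E u v.+1 = run E u v && E v.
Proof.
by move=> uv; rewrite /run subSn // -addn1 iotaD all_cat subnKC //= andbT.
Qed.

(** Length of the run of E that starts at x, cut at n.  Writing it as a sum over the
    end points of runs makes [sum_rooms] a mere exchange of summations. *)
Definition up_room (E : pred nat) (n x : nat) : nat :=
  \sum_(x.+1 <= v < n.+1) run E x v.

Definition down_room (E : pred nat) (x : nat) : nat :=
  \sum_(0 <= u < x) run E u x.

Lemma up_room_in (E : pred nat) n x : (x < n)%N -> E x ->
  up_room E n x = (up_room E n x.+1).+1.
Proof.
move=> xn Ex; rewrite /up_room big_ltn // run_first // Ex /run subnn /= add1n.
congr _.+1; apply: eq_big_nat => v /andP[xv _].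
by rewrite -/(run E x v) run_first ?Ex // ltnW.
Qed.

Lemma up_room_out (E : pred nat) n x : ~~ E x -> up_room E n x = 0%N.
Proof.
move=> Ex; rewrite /up_room big_nat_cond big1 // => v /andP[/andP[xv _] _].
by rewrite run_first // (negPf Ex).
Qed.

Lemma up_room_le (E : pred nat) n x : (up_room E n x <= n - x)%N.
Proof.
have h : (up_room E n x <= \sum_(x.+1 <= v < n.+1) 1)%N.
  by apply: leq_sum => v _; case: run.
by rewrite sum_nat_const_nat muln1 subSS in h.
Qed.

Lemma down_roomS (E : pred nat) x :
  down_room E x.+1 = if E x then (down_room E x).+1 else 0%N.
Proof.
rewrite /down_room; case: ifPn => Ex.
  rewrite big_nat_recr //= run_last // Ex andbT /run subnn /= addn1.
  congr _.+1; apply: eq_big_nat => u /andP[_ ux].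
  by rewrite -/(run E u x.+1) run_last ?Ex ?andbT // ltnW.
rewrite big_nat_cond big1 // => u /andP[/andP[_ ux] _].
by rewrite run_last // (negPf Ex) andbF.
Qed.

Lemma down_room_le (E : pred nat) x : (down_room E x <= x)%N.
Proof.
elim: x => [|x IH]; first by rewrite /down_room big_geq.
by rewrite down_roomS; case: ifP.
Qed.

(** Both sides are sums over the pairs u < v joined by a run of E, of q v on the
    left and of q u on the right, and q v < q u for each of them. *)
Lemma sum_rooms (R : realDomainType) (E : pred nat) n (q : nat -> R) :
    (forall x, E x -> (x < n)%N) -> (exists x, E x) ->
    (forall x, E x -> q x.+1 < q x) ->
  \sum_(x < n.+1) q x * (down_room E x)%:R < \sum_(x < n.+1) q x * (up_room E n x)%:R.
Proof.
move=> En [x0 Ex0] qE.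
have qrun u v : (u < v)%N -> run E u v -> q v < q u.
  elim: v => // v IH; rewrite ltnS leq_eqVlt => /orP[/eqP <-|uv].
    by rewrite run_first // => /andP[/qE].
  by rewrite run_last ?(ltnW uv) // => /andP[/(IH uv) h /qE /lt_trans]; exact.
have -> : \sum_(x < n.+1) q x * (down_room E x)%:R =
    \sum_(u < n.+1) \sum_(v < n.+1 | (u < v)%N) q v * (run E u v)%:R.
  rewrite [RHS](exchange_big_dep predT) //=; apply: eq_bigr => v _.
  rewrite -mulr_sumr /down_room natr_sum big_mkord.
  rewrite (big_ord_widen_cond n.+1 predT (fun u => (run E u v)%:R)) //.
  exact: ltnW.
have -> : \sum_(x < n.+1) q x * (up_room E n x)%:R =
    \sum_(u < n.+1) \sum_(v < n.+1 | (u < v)%N) q u * (run E u v)%:R.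
  apply: eq_bigr => u _; rewrite -mulr_sumr /up_room natr_sum; congr (_ * _).
  rewrite (big_nat_widenl _ 0) // big_mkord.
  exact: eq_bigl.
rewrite -subr_gt0 -sumrB /=.
have ge0 (u v : 'I_n.+1) : (u < v)%N ->
    0 <= q u * (run E u v)%:R - q v * (run E u v)%:R.
  move=> uv; case: (boolP (run E u v)) => [/(qrun _ _ uv)|_].
    by rewrite !mulr1 subr_ge0 => /ltW.
  by rewrite !mulr0 subrr.
have x0n := En _ Ex0.
have x0n' : (x0 < n.+1)%N by exact: ltnW.
rewrite (bigD1 (Ordinal x0n')) //=; apply: ltr_wpDr.
  by apply: sumr_ge0 => u _; rewrite -sumrB; apply: sumr_ge0 => v; exact: ge0.
have x1n : (x0.+1 < n.+1)%N by [].
rewrite -sumrB (bigD1 (Ordinal x1n)) //=; apply: ltr_wpDr.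
  by apply: sumr_ge0 => v /andP[uv _]; apply: (ge0 (Ordinal x0n')).
by rewrite run_first // Ex0 /run subnn !mulr1 subr_gt0 qE.
Qed.

(** * Optimal tuples *)

Definition move (K : nat) (T : 'I_K -> nat) (i j : 'I_K) : 'I_K -> nat :=
  fun k => if k == i then (T i).+1 else if k == j then (T j).-1 else T k.

(** Only two factors change; stated so that no inverse of [op] is needed, the
    same lemma serves for the total of the tuple and for its value. *)
Lemma big_move (M : Type) (idx : M) (op : Monoid.com_law idx) (f : nat -> M)
    (K : nat) (T : 'I_K -> nat) (i j : 'I_K) : i != j ->
  op (op (f (T i)) (f (T j))) (\big[op/idx]_k f (move T i j k)) =
  op (op (f (T i).+1) (f (T j).-1)) (\big[op/idx]_k f (T k)).
Proof.
move=> ij; have ji : j != i by rewrite eq_sym.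
rewrite (bigD1 i) // (bigD1 j) //= [in RHS](bigD1 i) // [in RHS](bigD1 j) //=.
rewrite /move eqxx (negPf ji) eqxx.
have -> : \big[op/idx]_(k | (k != i) && (k != j))
      f (if k == i then (T i).+1 else if k == j then (T j).-1 else T k) =
    \big[op/idx]_(k | (k != i) && (k != j)) f (T k).
  by apply: eq_bigr => k /andP[/negPf -> /negPf ->].
set A := f (T i); set B := f (T j); set C := f _; set D := f _; set X := bigop _ _ _.
by rewrite [op C (op D X)]Monoid.mulmA [op A (op B X)]Monoid.mulmA Monoid.mulmCA !Monoid.mulmA.
Qed.

Definition optimal (R : numDomainType) (K n c : nat) (phi : nat -> R)
    (T : 'I_K -> nat) : Prop :=
  [/\ forall i, (T i <= n)%N, (\sum_i T i <= c)%N &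
      forall T' : 'I_K -> nat, (forall i, T' i <= n)%N -> (\sum_i T' i <= c)%N ->
        \sum_i phi (T' i) <= \sum_i phi (T i)].

Definition steepest (R : numDomainType) (n : nat) (phi : nat -> R) (g : R) : pred nat :=
  fun x => (x < n)%N && (phi x.+1 - phi x == g).

(** The transfer gains g at T i and loses at most g at T j; since it cannot
    increase the value, it loses exactly g. *)
Lemma optimal_move (R : realDomainType) (K n c : nat) (phi : nat -> R) (g : R)
    (T : 'I_K -> nat) (i j : 'I_K) :
    (forall x, (x < n)%N -> phi x.+1 - phi x <= g) ->
    optimal n c phi T -> i != j -> steepest n phi g (T i) -> (0 < T j)%N ->
  steepest n phi g (T j).-1 /\ optimal n c phi (move T i j).
Proof.
move=> gmax [Tn Tc Tmax] ij /andP[Tin /eqP gi] Tj0.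
have mn k : (move T i j k <= n)%N.
  rewrite /move; case: ifP => // _; case: ifP => // _.
  exact: leq_trans (leq_pred _) (Tn j).
have mS : (\sum_k move T i j k = \sum_k T k)%N.
  have := @big_move _ _ addn id _ T _ _ ij; rewrite /= => h.
  by apply/eqP; rewrite -(eqn_add2l (T i + T j)) h -[in (T i + T j)%N](prednK Tj0) addnS addSn.
have mc : (\sum_k move T i j k <= c)%N by rewrite mS.
have mphi := @big_move _ _ +%R phi _ T _ _ ij.
have Tjn : ((T j).-1 < n)%N by rewrite prednK.
have gj := gmax _ Tjn; rewrite prednK // in gj.
have le_max := Tmax _ mn mc.
move: mphi le_max => /=; set A := \sum_k phi (move T i j k); set B := \sum_k phi (T k).
move=> mphi le_max.
have gj' : phi (T j) - phi (T j).-1 = g by apply/eqP; rewrite eq_le gj /=; lra.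
split; first by rewrite /steepest Tjn prednK // gj' eqxx.
have AB : A = B by lra.
by split=> // T' T'n T'c; rewrite -/A AB; exact: Tmax.
Qed.

(** If some other coordinate can go up inside E, let it do so and T j go down:
    both sides of the inequality lose one, and the tuple stays optimal.  When T j
    reaches the bottom of its run, which is positive, no exchange is possible any
    more, since it would put the position just below in E; so the other
    coordinates must have exhausted their runs by then. *)
Lemma room_le (R : realDomainType) (K n c : nat) (phi : nat -> R) (g : R)
    (E := steepest n phi g) (T : 'I_K -> nat) (j : 'I_K) :
    (forall x, (x < n)%N -> phi x.+1 - phi x <= g) ->
    optimal n c phi T -> (down_room E (T j) < T j)%N ->
  (\sum_(i | i != j) up_room E n (T i) <= down_room E (T j))%N.
Proof.
move=> gmax; have [m] := ubnP (down_room E (T j)).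
elim: m T => // m IH T /ltnSE Tm Topt Tj; rewrite leqNgt; apply/negP => lt_r.
have [i ij ri] : exists2 i, i != j & (0 < up_room E n (T i))%N.
  apply/exists_inP; apply: contraTT lt_r; rewrite negb_exists_in => /forall_inP h.
  by rewrite big1 // => i /h; rewrite -leqNgt leqn0 => /eqP.
have Ei : E (T i) by apply: contraTT ri => /(up_room_out n) ->.
have Tj0 : (0 < T j)%N by exact: leq_ltn_trans Tj.
have [Ej mopt] := optimal_move gmax Topt ij Ei Tj0.
have dj : down_room E (T j) = (down_room E (T j).-1).+1.
  by rewrite -{1}(prednK Tj0) down_roomS /E Ej.
have mj : move T i j j = (T j).-1 by rewrite /move eq_sym (negPf ij) eqxx.
have Tj' : (down_room E (T j).-1 < (T j).-1)%N by rewrite -ltnS prednK // -dj.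
rewrite dj in Tm lt_r.
have := IH _ _ mopt; rewrite mj => /(_ Tm Tj'); apply/negP; rewrite -ltnNge.
have Ti_n : (T i < n)%N by case/andP: Ei.
move: lt_r; rewrite (bigD1 i) //= (up_room_in Ti_n Ei) addSn ltnS.
rewrite [X in _ -> (_ < X)%N](bigD1 i) //= {1}/move eqxx.
suff -> : (\sum_(k | (k != j) && (k != i)) up_room E n (move T i j k) =
   \sum_(k | (k != j) && (k != i)) up_room E n (T k))%N by [].
by apply: eq_bigr => k /andP[/negPf kj /negPf ki]; rewrite /move ki kj.
Qed.

(** Unused budget excludes any position in E, as such a coordinate could be
    raised with a gain g > 0.  If the budget is used up, [room_le] is added
    over two coordinates that do not stand on the initial run; if there is only one
    such coordinate j, the room above it is at most n - T j, hence at most the sum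
    of the other coordinates, which all equal their rooms below. *)
Lemma optimal_rooms (R : realDomainType) (K n c : nat) (phi : nat -> R) (g : R)
    (E := steepest n phi g) (T : 'I_K -> nat) :
    (forall x, (x < n)%N -> phi x.+1 - phi x <= g) -> 0 < g -> (n <= c)%N ->
    optimal n c phi T ->
  (\sum_i up_room E n (T i) <= \sum_i down_room E (T i))%N \/
  ((\sum_i T i)%N = c /\ forall i, down_room E (T i) = T i).
Proof.
move=> gmax g0 nc Topt; have [Tn Tc Tmax] := Topt.
have [Tlt|] := ltnP (\sum_i T i) c.
  left; rewrite big1 // => i _; apply: up_room_out; apply/negP => /andP[Ti /eqP gi].
  pose T' k := if k == i then (T i).+1 else T k.
  have T'E (M : Type) (idx : M) (op : Monoid.com_law idx) (f : nat -> M) :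
      \big[op/idx]_k f (T' k) = op (f (T i).+1) (\big[op/idx]_(k | k != i) f (T k)).
    rewrite (bigD1 i) //= /T' eqxx; congr (op _ _).
    by apply: eq_bigr => k /negPf ->.
  have T'n k : (T' k <= n)%N by rewrite /T'; case: ifP.
  have T'c : (\sum_k T' k <= c)%N.
    by have /= -> := T'E _ _ addn id; move: Tlt; rewrite addSn (bigD1 i).
  have := Tmax _ T'n T'c; have /= -> := T'E _ _ +%R phi; rewrite [X in _ <= X](bigD1 i) //= lerD2r.
  by rewrite leNgt -subr_gt0 gi g0.
move=> c_le.
have Tc' : (\sum_i T i)%N = c by apply/eqP; rewrite eqn_leq Tc c_le.
have [[j Tj]|full] := pselect (exists j, (down_room E (T j) < T j)%N); last first.
  right; split => // i; apply/eqP; rewrite eqn_leq down_room_le leqNgt.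
  by apply/negP => lt_i; apply: full; exists i.
left; have rj := room_le gmax Topt Tj.
have [[j' j'j Tj']|full] :=
    pselect (exists2 j', j' != j & (down_room E (T j') < T j')%N).
  have rj' := room_le gmax Topt Tj'.
  have jj' : j != j' by rewrite eq_sym.
  have s_j (f : nat -> nat) : (\sum_(i | i != j) f (T i))%N =
      (f (T j') + \sum_(i | (i != j) && (i != j')) f (T i))%N by rewrite (bigD1 j').
  have s_j' (f : nat -> nat) : (\sum_(i | i != j') f (T i))%N =
      (f (T j) + \sum_(i | (i != j) && (i != j')) f (T i))%N.
    by rewrite (bigD1 j) //=; congr addn; apply: eq_bigl => i; rewrite andbC.
  have s_all (f : nat -> nat) : (\sum_i f (T i))%N =
      (f (T j) + (f (T j') + \sum_(i | (i != j) && (i != j')) f (T i)))%N.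
    by rewrite (bigD1 j) //= s_j.
  move: rj rj'; rewrite -/E (s_j (up_room E n)) (s_j' (up_room E n)).
  rewrite (s_all (up_room E n)) (s_all (down_room E)); lia.
have dE i : i != j -> down_room E (T i) = T i.
  move=> ij; apply/eqP; rewrite eqn_leq down_room_le leqNgt.
  by apply/negP => lt_i; apply: full; exists i.
rewrite (bigD1 j) //= [in X in (_ <= X)%N](bigD1 j) //= addnC leq_add //.
rewrite (eq_bigr _ dE); apply: leq_trans (up_room_le _ _ _) _.
by rewrite leq_subLR (leq_trans nc) // -Tc' (bigD1 j).
Qed.

Lemma down_room_full (R : realDomainType) (n : nat) (phi : nat -> R) (g : R) x :
  down_room (steepest n phi g) x = x -> phi x = phi 0%N + g *+ x.
Proof.
elim: x => [|x IH]; first by rewrite mulr0n addr0.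
rewrite down_roomS; case: ifP => // /andP[_ /eqP gx] [] /IH phix.
by rewrite mulrS addrCA -phix -gx subrK.
Qed.

(** * Mixing of nonincreasing laws *)

Lemma sum_slopes (R : numDomainType) (n : nat) (phi : nat -> R) (g : R) x :
  (forall y, (y < n)%N -> phi y.+1 - phi y <= g) -> (x <= n)%N ->
  phi x <= phi 0%N + g *+ x.
Proof.
move=> gmax; elim: x => [|x IH] xn; first by rewrite mulr0n addr0.
have := gmax _ xn; have := IH (ltnW xn); rewrite mulrS addrCA lerBlDr => h1 h2.
by apply: le_trans h2 _; rewrite lerD2l.
Qed.

(** A coupling of K copies of p, up to a permutation of the copies: only the
    expected number of coordinates equal to x is prescribed.  The weights are
    those of the nearest point q to K p, and the point is to show q = K p. *)
Lemma mixing_counts (R : realType) (K n c : nat) (p : nat -> R) :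
    (0 < K)%N -> (n <= c)%N ->
    \sum_(x < n.+1) p x = 1 ->
    (forall x, 0 <= p x) ->
    (forall x, (x < n)%N -> p x.+1 <= p x) ->
    K%:R * \sum_(x < n.+1) p x * x%:R <= c%:R ->
  exists w : {ffun 'I_K -> 'I_n.+1} -> R,
    [/\ forall T, 0 <= w T,
        forall T, w T != 0 -> (\sum_i T i <= c)%N,
        \sum_T w T = 1 &
        forall x : 'I_n.+1, \sum_T w T * (\sum_i (T i == x)%:R) = K%:R * p x].
Proof.
move=> K0 nc p1 p0 pdec pmean.
pose A (T : {ffun 'I_K -> 'I_n.+1}) := (\sum_i T i <= c)%N.
pose v (T : {ffun 'I_K -> 'I_n.+1}) (x : 'I_n.+1) : R := \sum_i (T i == x)%:R.
have [|w [w0 wA w1 wopt]] := closest_convex_combination (D := A) v (fun x => K%:R * p x).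
  by exists [ffun=> ord0]; rewrite /A big1 // => i _; rewrite ffunE.
pose q x := \sum_k w k * v k x; pose phi (x : 'I_n.+1) := K%:R * p x - q x.
have vE (f : 'I_n.+1 -> R) T : \sum_x f x * v T x = \sum_i f (T i).
  rewrite /v; under eq_bigr do rewrite mulr_sumr.
  rewrite exchange_big; apply: eq_bigr => i _.
  rewrite (bigD1 (T i)) //= eqxx mulr1 big1 ?addr0 // => x xi.
  by rewrite eq_sym (negPf xi) mulr0.
have qE (f : 'I_n.+1 -> R) : \sum_x f x * q x = \sum_T w T * \sum_i f (T i).
  under eq_bigr do rewrite mulr_sumr.
  rewrite exchange_big; apply: eq_bigr => T _.
  by rewrite -vE mulr_sumr; apply: eq_bigr => x _; rewrite mulrCA.
have [phi0|phi_n0] := pselect (forall x, phi x = 0).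
  exists w; split => // [T|x]; first by apply: contraNT => /wA/eqP.
  by apply/esym/eqP; rewrite -subr_eq0 -/(v _ x) -/(q x) -/(phi x) phi0.
exfalso.
pose M := \sum_x phi x * q x.
have leM T : A T -> \sum_i phi (T i) <= M.
  move=> AT; rewrite -subr_le0 -vE -sumrB; apply: le_trans (wopt T AT).
  by apply: ler_sum => x _; rewrite mulrBr.
have eqM T : w T != 0 -> \sum_i phi (T i) = M.
  have w_ge0 T' : true -> 0 <= w T' * (M - \sum_i phi (T' i)).
    have [/leM h|/wA ->] := boolP (A T'); last by rewrite mul0r.
    by rewrite mulr_ge0 // subr_ge0.
  have w_sum0 : \sum_T' w T' * (M - \sum_i phi (T' i)) = 0.
    under eq_bigr do rewrite mulrBr.
    by rewrite sumrB -mulr_suml w1 mul1r -qE subrr.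
  move=> /negPf wT; have /eqP := psumr_eq0P w_ge0 w_sum0 (i := T) isT.
  by rewrite mulf_eq0 wT subr_eq0 => /eqP.
have ltM : M < K%:R * \sum_(x < n.+1) phi x * p x.
  have -> : K%:R * \sum_(x < n.+1) phi x * p x = \sum_x phi x ^+ 2 + M.
    rewrite mulr_sumr -big_split; apply: eq_bigr => x _ /=.
    by rewrite /phi; ring.
  rewrite ltrDr lt_neqAle sumr_ge0 ?andbT; last by move=> x _; exact: sqr_ge0.
  rewrite eq_sym; apply/negP => /eqP s0; apply: phi_n0 => x.
  have /eqP := psumr_eq0P (fun y _ => sqr_ge0 (phi y)) s0 (i := x) isT.
  by rewrite sqrf_eq0 => /eqP.
pose phi' (x : nat) := phi (inord x).
have phi'E (x : 'I_n.+1) : phi' x = phi x by rewrite /phi' inord_val.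
have leM' (T : 'I_K -> nat) : (forall i, T i <= n)%N -> (\sum_i T i <= c)%N ->
    \sum_i phi' (T i) <= M.
  move=> Tn Tc; pose T' : {ffun 'I_K -> 'I_n.+1} := [ffun i => inord (T i)].
  have AT' : A T'.
    by rewrite /A (eq_bigr T) // => i _; rewrite ffunE inordK // ltnS.
  apply: le_trans (leM _ AT'); apply: ler_sum => i _.
  by rewrite ffunE.
have sum_p_le (a b : R) : (forall x : 'I_n.+1, phi x <= a + b *+ x) -> 0 <= b ->
    K%:R * \sum_(x < n.+1) phi x * p x <= K%:R * a + b * c%:R.
  move=> phi_le b0.
  apply: le_trans (_ : K%:R * \sum_(x < n.+1) (a * p x + b * (p x * x%:R)) <= _).
    apply: ler_wpM2l => //; apply: ler_sum => x _.
    have -> : a * p x + b * (p x * x%:R) = (a + b *+ x) * p x.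
      by rewrite -[b *+ x]mulr_natr; ring.
    exact: ler_wpM2r.
  rewrite big_split /= -!mulr_sumr p1 mulr1 mulrDr lerD2l mulrCA.
  exact: ler_wpM2l.
(* Without a positive slope the zero tuple would be optimal, with value at least
   the average of phi under K p. *)
have [y yn gy] : exists2 y : nat, (y < n)%N & 0 < phi' y.+1 - phi' y.
  apply/not_exists2P => slope_le.
  have phi_le (x : 'I_n.+1) : phi x <= phi' 0%N + 0 *+ x.
    rewrite -phi'E; apply: (@sum_slopes _ n phi' 0 x _ (ltn_ord x)) => y yn.
    by have [|/negP] := slope_le y; rewrite -?leNgt.
  have := sum_p_le _ _ phi_le (lexx _); rewrite mul0r addr0 leNgt => /negP; apply.
  apply: le_lt_trans ltM; have := leM' (fun=> 0%N) (fun=> leq0n n).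
  by rewrite big1 // => /(_ isT); rewrite sumr_const card_ord mulr_natl.
pose slope (x : 'I_n) := phi' x.+1 - phi' x.
have [m mmax] : exists m, forall x, slope x <= slope m.
  case: (@Order.TotalTheory.arg_maxP _ _ 'I_n (Ordinal yn) xpredT slope) => // m _ mmax.
  by exists m => x; exact: mmax.
pose g := slope m.
have gmax x : (x < n)%N -> phi' x.+1 - phi' x <= g.
  by move=> xn; exact: (mmax (Ordinal xn)).
have g0 : 0 < g by exact: lt_le_trans gy (gmax _ yn).
pose E := steepest n phi' g.
have En0 : exists x, E x by exists m; rewrite /E /steepest ltn_ord eqxx.
pose q' x := K%:R * p x - phi' x.
have q'E (x : 'I_n.+1) : q' x = q x by rewrite /q' phi'E /phi opprB addrC subrK.
have q'dec x : E x -> q' x.+1 < q' x.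
  move=> /andP[xn /eqP gx]; rewrite /q'.
  have : K%:R * p x.+1 <= K%:R * p x by rewrite ler_wpM2l // pdec.
  by move: g0; rewrite -gx; lra.
have := @sum_rooms _ E n q' (fun x => fun h => proj1 (andP h)) En0 q'dec.
apply/negP; rewrite -leNgt.
under eq_bigr do rewrite q'E mulrC.
under [leRHS]eq_bigr do rewrite q'E mulrC.
rewrite !qE; apply: ler_sum => T _.
have [->|wT] := eqVneq (w T) 0; first by rewrite !mul0r.
rewrite ler_wpM2l // -!natr_sum ler_nat.
have AT : A T by apply: contraNT wT => /wA/eqP.
(* By complementary slackness the tuples that carry mass are optimal. *)
have Topt : optimal n c phi' (fun i => T i : nat).
  split=> // [i|T' T'n T'c]; first by rewrite -ltnS.
  apply: le_trans (leM' _ T'n T'c) _.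
  by rewrite -(eqM _ wT); apply: ler_sum => i _; rewrite phi'E.
have [//|[Tc full]] := optimal_rooms gmax g0 nc Topt.
(* On the initial run phi is affine with the maximal slope g, and T spends the
   whole budget c there.  Since phi is everywhere below that affine function and
   the mean of K p is at most c, the average of phi under K p is at most M. *)
exfalso; move: ltM; rewrite ltNge => /negP; apply.
have phi_le (x : 'I_n.+1) : phi x <= phi' 0%N + g *+ x.
  by rewrite -phi'E; exact: (sum_slopes gmax (ltn_ord x)).
apply: le_trans (sum_p_le _ _ phi_le (ltW g0)) _.
rewrite -(eqM _ wT) le_eqVlt; apply/orP; left; apply/eqP.
transitivity (\sum_(i < K) (phi' 0%N + g *+ T i)).
  rewrite big_split /= sumr_const card_ord sumrMnr Tc.
  by rewrite mulr_natl mulr_natr.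
by apply: eq_bigr => i _; rewrite -(down_room_full (full i)) phi'E.
Qed.

(** Averaging the weights over the cyclic shifts of the coordinates turns the
    prescribed counts into prescribed marginals. *)
Lemma mixing_coordinates (R : realType) (K n c : nat) (p : nat -> R) :
    (0 < K)%N -> (n <= c)%N ->
    \sum_(x < n.+1) p x = 1 ->
    (forall x, 0 <= p x) ->
    (forall x, (x < n)%N -> p x.+1 <= p x) ->
    K%:R * \sum_(x < n.+1) p x * x%:R <= c%:R ->
  exists w : {ffun 'I_K -> 'I_n.+1} -> R,
    [/\ forall T, 0 <= w T,
        forall T, w T != 0 -> (\sum_i T i <= c)%N,
        \sum_T w T = 1 &
        forall (i : 'I_K) (x : 'I_n.+1), \sum_(T : {ffun 'I_K -> 'I_n.+1} | T i == x) w T = p x].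
Proof.
case: K => // k _ nc p1 p0 pdec pmean.
have [w [w0 wc w1 wp]] := mixing_counts (ltn0Sn k) nc p1 p0 pdec pmean.
pose sh (s : 'I_k.+1) (T : {ffun 'I_k.+1 -> 'I_n.+1}) := [ffun i => T (i + s)].
have shK s : cancel (sh s) (sh (- s)).
  by move=> T; apply/ffunP => i; rewrite !ffunE subrK.
have shNK s : cancel (sh (- s)) (sh s).
  by move=> T; apply/ffunP => i; rewrite !ffunE addrK.
have sh_sum s T : (\sum_i sh s T i = \sum_i T i)%N.
  rewrite [RHS](reindex_inj (addIr s)); apply: eq_bigr => i _.
  by rewrite ffunE.
pose w' T := k.+1%:R^-1 * \sum_s w (sh s T).
have K_n0 : k.+1%:R != 0 :> R by rewrite pnatr_eq0.
have w'E (f : {ffun 'I_k.+1 -> 'I_n.+1} -> R) :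
    \sum_T w' T * f T = k.+1%:R^-1 * \sum_T w T * \sum_s f (sh (- s) T).
  rewrite mulr_sumr; under eq_bigr do rewrite -mulrA.
  rewrite -!mulr_sumr; congr (_ * _).
  under eq_bigr do rewrite mulr_suml.
  under [RHS]eq_bigr do rewrite mulr_sumr.
  rewrite exchange_big [RHS]exchange_big; apply: eq_bigr => s _.
  rewrite [RHS](reindex_inj (can_inj (shK s))); apply: eq_bigr => T _.
  by rewrite shK.
exists w'; split.
- by move=> T; rewrite mulr_ge0 ?invr_ge0 // sumr_ge0.
- move=> T; rewrite mulf_eq0 negb_or => /andP[_ /eqP wT].
  apply/negP => /negP Tc; apply: wT; apply: big1 => s _; apply/eqP.
  by apply: contraNT Tc => /wc; rewrite sh_sum.
- have := w'E (fun=> 1); under eq_bigr do rewrite mulr1; move=> ->.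
  under eq_bigr do rewrite sumr_const card_ord.
  by rewrite -mulr_suml w1 mul1r mulVf.
- move=> i x; rewrite big_mkcond /=.
  under eq_bigr do rewrite -mulrb.
  under eq_bigr do rewrite -mulr_natr.
  rewrite (w'E (fun T => (T i == x)%:R)).
  have -> : \sum_T w T * (\sum_s (sh (- s) T i == x)%:R) = k.+1%:R * p x.
    rewrite -wp; apply: eq_bigr => T _; congr (_ * _).
    rewrite [RHS](reindex_inj (inj_comp (@addrI _ i) oppr_inj)).
    by apply: eq_bigr => s _; rewrite ffunE.
  by rewrite mulKf.
Qed.

(** * Atomless probability spaces *)

(** Real-valued probabilities, so that linear arithmetic applies. *)
Definition pr (R : realType) (d : measure_display) (T : measurableType d)
    (P : probability T R) (A : set T) : R := fine (P A).

Lemma prE (R : realType) (d : measure_display) (T : measurableType d)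
    (P : probability T R) (A : set T) : measurable A -> P A = (pr P A)%:E.
Proof. by move=> mA; rewrite /pr fineK // fin_num_measure. Qed.

Lemma pr_ge0 (R : realType) (d : measure_display) (T : measurableType d)
    (P : probability T R) (A : set T) : 0 <= pr P A.
Proof. exact: fine_ge0. Qed.

Lemma pr_set0 (R : realType) (d : measure_display) (T : measurableType d)
    (P : probability T R) : pr P set0 = 0.
Proof. by rewrite /pr measure0. Qed.

Lemma pr_le (R : realType) (d : measure_display) (T : measurableType d)
    (P : probability T R) (A B : set T) : measurable A -> measurable B ->
  A `<=` B -> pr P A <= pr P B.
Proof. by move=> mA mB AB; rewrite -lee_fin -!prE // le_measure ?inE. Qed.

Lemma pr_le1 (R : realType) (d : measure_display) (T : measurableType d)
    (P : probability T R) (A : set T) : measurable A -> pr P A <= 1.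
Proof. by move=> mA; rewrite -lee_fin -prE // probability_le1. Qed.

Lemma pr_setU (R : realType) (d : measure_display) (T : measurableType d)
    (P : probability T R) (A B : set T) : measurable A -> measurable B ->
  A `&` B = set0 -> pr P (A `|` B) = pr P A + pr P B.
Proof.
move=> mA mB AB; apply: EFin_inj; rewrite EFinD -!prE //; last exact: measurableU.
exact: measureU.
Qed.

Lemma pr_setD (R : realType) (d : measure_display) (T : measurableType d)
    (P : probability T R) (A B : set T) : measurable A -> measurable B ->
  B `<=` A -> pr P (A `\` B) = pr P A - pr P B.
Proof.
move=> mA mB BA; apply/eqP; rewrite eq_sym subr_eq; apply/eqP.
rewrite -pr_setU //; last 2 first.
- exact: measurableD.
- by rewrite setDE -setIA setICl setI0.
by rewrite setUC setDUK.
Qed.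

Lemma small_half_power (R : archiRealFieldType) (e : R) : 0 < e ->
  exists n, 2^-1 ^+ n <= e.
Proof.
move=> e0; have [n _ /(_ n (leqnn n))] := near_infty_natSinv_expn_lt (PosNum e0).
by rewrite /= div1r -exprVn => /ltW ?; exists n.
Qed.

(** A set of positive measure splits into two such sets, and the smaller of
    them has at most half the measure. *)
Lemma atomless_small_subset (R : realType) (d : measure_display)
    (T : measurableType d) (P : probability T R) (A : set T) (e : R) :
    atomless P -> measurable A -> 0 < pr P A -> 0 < e ->
  exists B : set T, [/\ measurable B, B `<=` A & 0 < pr P B <= e].
Proof.
move=> Pat mA PA e0.
have halve n : exists B : set T, [/\ measurable B, B `<=` A & 0 < pr P B <= 2^-1 ^+ n].
  elim: n => [|n [B [mB BA /andP[B0 Bn]]]].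
    by exists A; split => //; rewrite PA expr0 pr_le1.
  have [|C [mC CB]] := Pat B mB; first by rewrite prE ?lte_fin.
  rewrite !prE // !lte_fin => C0 CltB.
  have mBC : measurable (B `\` C) by exact: measurableD.
  have BC := pr_setD P mB mC CB.
  have [Ch|Ch] := leP (pr P C) (pr P B / 2).
    exists C; split => //; first exact: subset_trans BA.
    by rewrite C0 exprS mulrC /= (le_trans Ch) // ler_pdivrMr // divfK.
  exists (B `\` C); split => //; first by apply: subset_trans BA; exact: subDsetl.
  rewrite BC subr_gt0 CltB /= exprS.
  by move: Bn Ch; set x := 2^-1 ^+ n; lra.
have [n ne] : exists n, (2^-1 : R) ^+ n <= e.
  exact: small_half_power.
have [B [mB BA /andP[B0 Bn]]] := halve n.
by exists B; split=> //; rewrite B0 (le_trans Bn).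
Qed.

(** Sierpinski's theorem.  Exhaust A greedily: each step adds a set that fits
    below t and has at least half of the largest possible measure.  If the union
    U fell short of t, a small set D disjoint from U would have fitted at every
    step, so every step would have added at least half of the measure of D. *)
Lemma atomless_intermediate_value (R : realType) (d : measure_display)
    (T : measurableType d) (P : probability T R) (A : set T) (t : R) :
    atomless P -> measurable A -> 0 <= t <= pr P A ->
  exists B : set T, [/\ measurable B, B `<=` A & pr P B = t].
Proof.
move=> Pat mA /andP[t0 tA].
pose ok B := [/\ measurable B, B `<=` A & pr P B <= t].
pose large B B' := forall C, measurable C -> C `<=` A `\` B -> pr P B + pr P C <= t ->
  pr P C <= 2 * (pr P B' - pr P B).
have step B : exists B', ok B -> [/\ ok B', B `<=` B' & large B B'].
  have [[mB BA Bt]|nok] := pselect (ok B); last by exists set0.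
  pose S := [set x | exists C, [/\ measurable C, C `<=` A `\` B,
                                  pr P B + pr P C <= t & x = pr P C]].
  have S0 : S 0 by exists set0; split; rewrite ?pr_set0 ?addr0.
  have hS : has_sup S.
    split; first by exists 0.
    by exists 1 => _ [C [mC _ _ ->]]; exact: pr_le1.
  have leS C : measurable C -> C `<=` A `\` B -> pr P B + pr P C <= t -> pr P C <= sup S.
    by move=> mC CA Ct; apply: ub_le_sup; [exact: (proj2 hS)|exists C].
  have [s0|s0] := leP (sup S) 0.
    exists B => _; split => // C mC CA Ct.
    by rewrite subrr mulr0 (le_trans (leS _ mC CA Ct)).
  have [_ [C [mC CA Ct ->]] Cs] := sup_adherent (divr_gt0 s0 (ltr0n R 2)) hS.
  have BC0 : B `&` C = set0.
    by apply/seteqP; split => x // -[Bx /CA[_]].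
  have BC : pr P (B `|` C) = pr P B + pr P C by exact: pr_setU.
  exists (B `|` C) => _; split => //; first split.
  - exact: measurableU.
  - by move=> x [/BA//|/CA[]].
  - by rewrite BC.
  - move=> D mD DA Dt; apply: (le_trans (leS _ mD DA Dt)); rewrite BC.
    by move: Cs; set s := sup S; lra.
have [f fP] := choice step.
pose B n := iter n f set0.
have okB n : ok (B n).
  elim: n => [|n IH]; last by have [] := fP _ IH.
  by split; [exact: measurable0|exact: sub0set|rewrite pr_set0].
have mB n : measurable (B n) by have [] := okB n.
have BS n : B n `<=` B n.+1 by have [] := fP _ (okB n).
have BL n : large (B n) (B n.+1) by have [] := fP _ (okB n).
have ndB : {homo B : n m / (n <= m)%N >-> (n <= m)%O}.
  apply: homo_leq => //; first exact: le_trans.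
  by move=> n; apply/subsetPset.
pose U := \bigcup_n B n.
have mU : measurable U by exact: bigcup_measurable.
have UA : U `<=` A by move=> x [n _]; have [_ + _] := okB n; exact.
have Ut : pr P U <= t.
  rewrite -lee_fin -prE //.
  have cU := nondecreasing_cvg_mu (mu := P) mB mU ndB.
  rewrite -(cvg_lim _ cU) //; apply: lime_le; first by apply/cvg_ex; exists (P U).
  by apply: nearW => n /=; rewrite prE // lee_fin; have [] := okB n.
exists U; split => //; apply/eqP; rewrite eq_le Ut leNgt; apply/negP => Ult.
have mAU : measurable (A `\` U) by exact: measurableD.
have AU0 : 0 < pr P (A `\` U) by rewrite pr_setD // subr_gt0 (lt_le_trans Ult).
have tU0 : 0 < t - pr P U by rewrite subr_gt0.
have [D [mD DAU /andP[D0 DtU]]] := atomless_small_subset Pat mAU AU0 tU0.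
(* D is still available at every step. *)
have grow n : n%:R * pr P D <= 2 * pr P (B n).
  elim: n => [|n IH]; first by rewrite mul0r mulr_ge0 // pr_ge0.
  have DA : D `<=` A `\` B n.
    by move=> x /DAU[Ax Ux]; split => // Bx; apply: Ux; exists n.
  have BU : pr P (B n) <= pr P U by apply: pr_le => // x Bx; exists n.
  have Dt : pr P (B n) + pr P D <= t by move: DtU BU; lra.
  have := BL n D mD DA Dt; rewrite -[n.+1%:R]natr1 [(n%:R + 1) * _]mulrDl mul1r.
  by move: IH; set y := n%:R * _; lra.
have := grow (Num.trunc (2 / pr P D)).+1; apply/negP; rewrite -ltNge.
rewrite -ltr_pdivrMr //; apply: le_lt_trans (truncnS_gt _).
by rewrite ler_pM2r ?invr_gt0 // -[leRHS]mulr1 ler_wpM2l // pr_le1.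
Qed.

(** Sets indexed by the dyadic fractions j / 2^k: level k + 1 keeps the sets of
    level k and inserts one between consecutive ones.  Level 0 is A at all
    positive indices, so that every level is increasing on the whole of nat. *)
Fixpoint dyadic_chain (T : Type) (mid : set T -> set T -> set T) (A : set T)
    (k j : nat) : set T :=
  if k is k'.+1 then
    if odd j then mid (dyadic_chain mid A k' j./2) (dyadic_chain mid A k' j./2.+1)
    else dyadic_chain mid A k' j./2
  else if j is 0 then set0 else A.

Definition dyadic (R : realType) (k j : nat) : R := j%:R / 2 ^+ k.

Lemma dyadic_chain_refine (T : Type) mid (A : set T) k m j :
  dyadic_chain mid A (m + k) (j * 2 ^ m) = dyadic_chain mid A k j.
Proof.
elim: m => [|m IH] /=; first by rewrite muln1.
by rewrite expnS mulnCA mul2n odd_double doubleK.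
Qed.

(** Interpolation at half of the measure by [atomless_intermediate_value]. *)
Lemma atomless_dyadic_chain (R : realType) (d : measure_display)
    (T : measurableType d) (P : probability T R) (A : set T) :
    atomless P -> measurable A ->
  exists D : nat -> nat -> set T,
    [/\ forall k j, measurable (D k j), forall k, D k (2 ^ k)%N = A,
        forall k j k' j', dyadic R k j < dyadic R k' j' -> D k j `<=` D k' j' &
        forall k j, (j <= 2 ^ k)%N -> pr P (D k j) = dyadic R k j * pr P A].
Proof.
move=> Pat mA.
have ex_mid (XY : set T * set T) : exists Z, measurable XY.1 -> measurable XY.2 ->
    XY.1 `<=` XY.2 ->
    [/\ measurable Z, XY.1 `<=` Z, Z `<=` XY.2 & pr P Z = (pr P XY.1 + pr P XY.2) / 2].
  case: XY => X Y /=.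
  have [[mX mY XY]|nok] := pselect [/\ measurable X, measurable Y & X `<=` Y]; last first.
    by exists set0 => mX mY XY; exfalso; apply: nok.
  have le_XY := pr_le P mX mY XY.
  have mYX : measurable (Y `\` X) by exact: measurableD.
  have [|B [mB BYX PB]] :=
      @atomless_intermediate_value _ _ _ P (Y `\` X) ((pr P Y - pr P X) / 2) Pat mYX.
    by rewrite pr_setD //; apply/andP; split; lra.
  exists (X `|` B) => _ _ _; split.
  - exact: measurableU.
  - exact: subsetUl.
  - by move=> x [/XY//|/BYX[]].
  - rewrite pr_setU // ?PB; first by lra.
    by apply/seteqP; split => x // -[Xx /BYX[]].
have [mid' midP'] := choice ex_mid.
pose mid X Y := mid' (X, Y).
have midP X Y : measurable X -> measurable Y -> X `<=` Y ->
    [/\ measurable (mid X Y), X `<=` mid X Y, mid X Y `<=` Y &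
        pr P (mid X Y) = (pr P X + pr P Y) / 2] by exact: midP' (X, Y).
pose D := dyadic_chain mid A.
have DP k : (forall j, measurable (D k j)) /\ (forall j, D k j `<=` D k j.+1).
  elim: k => [|k [mD DS]]; first by split=> -[|j] /=; [exact: measurable0|exact: mA|exact: sub0set|exact: subset_refl].
  split => j; have [mM m1 m2 _] := midP _ _ (mD j./2) (mD j./2.+1) (DS _).
    by rewrite /D /=; case: (odd j) => //; exact: mD.
  by rewrite /D /= uphalf_half; case: (odd j); rewrite /= ?add0n ?add1n.
have mD k j : measurable (D k j) by have [] := DP k.
have D_mono k i j : (i <= j)%N -> D k i `<=` D k j.
  elim: j => [|j IH]; first by rewrite leqn0 => /eqP ->.
  rewrite leq_eqVlt => /orP[/eqP -> //|/IH h]; apply: subset_trans h _.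
  by have [_] := DP k; apply.
exists D; split => //.
- by move=> k; have := dyadic_chain_refine mid A 0 k 1; rewrite addn0 mul1n.
- move=> k j k' j' lt_jj'; rewrite /D -(dyadic_chain_refine mid A k k' j).
  rewrite -(dyadic_chain_refine mid A k' k j') addnC; apply: D_mono.
  move: lt_jj'; rewrite /dyadic ltr_pdivrMr ?exprn_gt0 // mulrAC ltr_pdivlMr ?exprn_gt0 //.
  by rewrite -!natrX -!natrM ltr_nat => /ltnW.
- elim=> [|k IH] j.
    rewrite /dyadic expr0 divr1; case: j => [|[|//]] _ /=; last by rewrite mul1r.
    by rewrite mul0r pr_set0.
  move=> jk; rewrite /D /=; have [_ _ _ mP] := midP _ _ (mD k j./2) (mD k j./2.+1) (proj2 (DP k) _).
  rewrite -/(D k _) -/(D k _); have := odd_double_half j; case: ifP => oj /= jE.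
    rewrite mP !IH; last 2 first.
    - by move: jk; rewrite -jE expnS; lia.
    - by move: jk; rewrite -jE expnS; lia.
    rewrite /dyadic -{3}jE exprS -[j./2.+1]addn1 -muln2 !natrD natrM.
    by field; rewrite expf_neq0.
  rewrite IH; last by move: jk; rewrite -jE expnS; lia.
  rewrite /dyadic -{2}jE exprS add0n -muln2 natrM.
  by field; rewrite expf_neq0.
Qed.

(** * Uniform variables *)

Lemma dyadic_floor (R : realType) (k : nat) (u : R) : 0 <= u < 1 ->
  exists j, [/\ (j < 2 ^ k)%N, dyadic R k j <= u & u < dyadic R k j.+1].
Proof.
move=> /andP[u0 u1]; have k0 : 0 < 2 ^+ k :> R by rewrite exprn_gt0.
have /andP[le_j lt_j] := truncn_itv (mulr_ge0 u0 (ltW k0)).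
exists (Num.trunc (u * 2 ^+ k)); rewrite /dyadic ler_pdivrMr // ltr_pdivlMr //.
split => //; rewrite -(ltr_nat R) natrX (le_lt_trans le_j) //.
by rewrite gtr_pMl.
Qed.

Lemma measurable_fun_of_lt (R : realType) (d : measure_display)
    (T : measurableType d) (h : T -> R) :
  (forall t, measurable [set x | h x < t]) -> measurable_fun setT h.
Proof.
move=> mh mT; apply: (measurability _ (measurable_realfun.RGenInftyO.measurableE R)) => //.
move=> /= _ [_ [t ->] <-]; rewrite setTI.
have -> : h @^-1` `]-oo, t[%classic = [set x | h x < t].
  by apply/seteqP; split => x /=; rewrite in_itv.
exact: mh.
Qed.

Lemma measurable_sublevel (R : realType) (d : measure_display)
    (T : measurableType d) (h : T -> R) (t : R) :
  measurable_fun setT h -> measurable [set x | h x <= t].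
Proof.
move=> mh; rewrite -[X in measurable X]setTI.
by apply: measurable_fun_le => //; exact: measurable_cst.
Qed.

Lemma measurable_strict_sublevel (R : realType) (d : measure_display)
    (T : measurableType d) (h : T -> R) (t : R) :
  measurable_fun setT h -> measurable [set x | h x < t].
Proof.
move=> mh; rewrite (_ : [set _ | _] = ~` [set x | t <= h x]).
  apply: measurableC; rewrite -[X in measurable X]setTI.
  by apply: measurable_fun_le => //; exact: measurable_cst.
by apply/seteqP; split => x /=; rewrite ltNge => /negP.
Qed.

(** h x is the infimum of the measures of the sets of a dyadic chain of A that
    contain x; the sublevel sets of h are squeezed between two neighbouring sets of the
    chain. *)
Lemma atomless_uniform_on (R : realType) (d : measure_display)
    (T : measurableType d) (P : probability T R) (A : set T) :
    atomless P -> measurable A ->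
  exists h : T -> R,
    [/\ measurable_fun setT h, forall x, 0 <= h x <= pr P A &
        forall t, 0 <= t <= pr P A -> pr P (A `&` [set x | h x <= t]) = t].
Proof.
move=> Pat mA; have [D [mD D1 D_mono PD]] := atomless_dyadic_chain Pat mA.
pose a := pr P A; have a0 : 0 <= a by exact: pr_ge0.
pose S x := [set t | exists k j, [/\ (j <= 2 ^ k)%N, D k j x & t = dyadic R k j * a]].
pose h x := if x \in A then inf (S x) else 0.
have dy0 k j : 0 <= dyadic R k j by rewrite divr_ge0 // exprn_ge0.
have Sa x : A x -> S x a.
  by move=> Ax; exists 0%N, 1%N; rewrite (D1 0%N) /dyadic expr0 divr1 mul1r.
have S_lb x : has_lbound (S x).
  by exists 0 => _ [k [j [_ _ ->]]]; rewrite mulr_ge0.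
have hS x t : A x -> S x t -> h x <= t.
  by move=> Ax St; rewrite /h mem_set //; exact: ge_inf.
have h_lt x t : A x -> h x < t -> exists2 s, S x s & s < t.
  by move=> Ax; rewrite /h mem_set // => /inf_lt; apply; exists a; exact: Sa.
have DA k j : (j <= 2 ^ k)%N -> D k j `<=` A.
  rewrite leq_eqVlt => /orP[/eqP ->|jk].
    by rewrite D1.
  rewrite -(D1 k); apply: D_mono; rewrite /dyadic ltr_pM2r ?invr_gt0 ?exprn_gt0 //.
  by rewrite ltr_nat.
have h01 x : 0 <= h x <= a.
  rewrite /h; case: ifPn => [/set_mem Ax|_]; last by rewrite lexx.
  rewrite ge_inf ?andbT //; last exact: Sa.
  by apply: lb_le_inf; [exists a; exact: Sa|move=> _ [k [j [_ _ ->]]]; rewrite mulr_ge0].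
have mh : measurable_fun setT h.
  apply: measurable_fun_of_lt => t.
  have -> : [set x | h x < t] = (A `&` \bigcup_k \bigcup_(j in [set j | (j <= 2 ^ k)%N /\ dyadic R k j * a < t]) D k j)
      `|` (~` A `&` [set _ | 0 < t]).
    apply/seteqP; split => x /=.
      move=> hxt; have [Ax|nAx] := pselect (A x).
        left; split => //; have [s [k [j [jk Dx ->]]] st] := h_lt _ _ Ax hxt.
        by exists k => //; exists j.
      by right; split => //; move: hxt; rewrite /h memNset.
    move=> [[Ax [k _ [j [jk jt] Dx]]]|[nAx t0]]; last by rewrite /h memNset.
    by apply: le_lt_trans jt; apply: hS => //; exists k, j.
  apply: measurableU.
    apply: measurableI => //; apply: bigcupT_measurable => k.
    by apply: bigcup_measurable => j _; exact: mD.
  apply: measurableI; first exact: measurableC.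
  have [t0|t0] := pselect (0 < t).
    by rewrite (_ : [set _ | _] = setT) //; apply/seteqP; split.
  by rewrite (_ : [set _ | _] = set0) //; apply/seteqP; split.
exists h; split => // t /andP[t0]; rewrite le_eqVlt => /orP[/eqP ->|ta].
  congr (pr P _); apply/seteqP; split => x /= => [[]//|Ax].
  by split => //; have /andP[] := h01 x.
have a_gt0 : 0 < a by exact: le_lt_trans ta.
have mAh : measurable (A `&` [set x | h x <= t]).
  by apply: measurableI => //; exact: measurable_sublevel.
apply/eqP; rewrite -subr_eq0 -normr_le0; apply/ler_addgt0Pr => e e0.
rewrite add0r; have [k ke] := small_half_power (divr_gt0 e0 a_gt0).
have [|j [jk le_j lt_j]] := @dyadic_floor R k (t / a).
  by rewrite divr_ge0 //= ltr_pdivrMr // mul1r.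
have D_lo : D k j `<=` A `&` [set x | h x <= t].
  move=> x Dx; have Ax := DA _ _ (ltnW jk) _ Dx; split => //=.
  apply: (@le_trans _ _ (dyadic R k j * a)); last by rewrite -ler_pdivlMr.
  by apply: hS => //; exists k, j; split => //; exact: ltnW.
have D_hi : A `&` [set x | h x <= t] `<=` D k j.+1.
  move=> x [Ax /= hxt]; have [|s [k' [j' [jk' Dx ->]]] st] := h_lt x (dyadic R k j.+1 * a) Ax.
    by rewrite (le_lt_trans hxt) // -ltr_pdivrMr.
  by apply: D_mono Dx; rewrite -(ltr_pM2r a_gt0).
have := pr_le P (mD k j) mAh D_lo; have := pr_le P mAh (mD k j.+1) D_hi.
rewrite !PD //; last exact: ltnW.
have -> : dyadic R k j.+1 = dyadic R k j + 2^-1 ^+ k.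
  by rewrite /dyadic -natr1 mulrDl mul1r exprVn.
rewrite -/a; move: ke le_j lt_j; rewrite ler_pdivlMr // ler_pdivlMr // ltr_pdivrMr //.
have -> : dyadic R k j.+1 = dyadic R k j + 2^-1 ^+ k.
  by rewrite /dyadic -natr1 mulrDl mul1r exprVn.
rewrite !mulrDl; set u := dyadic R k j * a; set v := 2^-1 ^+ k * a; set w := pr P _.
by move=> h1 h2 h3 h4 h5; rewrite ler_norml; apply/andP; split; lra.
Qed.

Lemma pr_partition (R : realType) (d : measure_display) (T : measurableType d)
    (P : probability T R) (I : finType) (Y : T -> I) (E : set T) :
    measurable E -> (forall i, measurable (Y @^-1` [set i])) ->
  pr P E = \sum_i pr P (E `&` Y @^-1` [set i]).
Proof.
move=> mE mY.
have key (s : seq I) : uniq s -> measurable (E `&` [set x | Y x \in s]) /\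
    pr P (E `&` [set x | Y x \in s]) = \sum_(i <- s) pr P (E `&` Y @^-1` [set i]).
  elim: s => [_|i s IH /= /andP[si us]].
    have -> : E `&` [set x | Y x \in [::]] = set0 by apply/seteqP; split => x // [].
    by rewrite big_nil pr_set0.
  have [ms Ps] := IH us.
  have mi : measurable (E `&` Y @^-1` [set i]) by exact: measurableI.
  have -> : E `&` [set x | Y x \in i :: s] =
      (E `&` Y @^-1` [set i]) `|` (E `&` [set x | Y x \in s]).
    apply/seteqP; split => x /=; rewrite in_cons.
      by case=> Ex /orP[/eqP ->|xs]; [left|right].
    by case=> [[Ex ->]|[Ex xs]]; rewrite ?eqxx ?xs ?orbT.
  split; first exact: measurableU.
  rewrite big_cons -Ps; apply: pr_setU => //.
  apply/seteqP; split => x //= -[[_ Yi] [_ Ys]].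
  by move: si; rewrite -Yi Ys.
have [_] := key _ (index_enum_uniq I); move=> <-.
by congr (pr P _); apply/seteqP; split => [x Ex|x [] //]; split; rewrite //= mem_index_enum.
Qed.

(** Cut off a set of measure w i for one i after the other. *)
Lemma atomless_discrete_law (R : realType) (d : measure_display)
    (T : measurableType d) (P : probability T R) (I : finType) (w : I -> R) :
    atomless P -> (forall i, 0 <= w i) -> \sum_i w i = 1 ->
  exists Y : T -> I,
    forall i, measurable (Y @^-1` [set i]) /\ pr P (Y @^-1` [set i]) = w i.
Proof.
move=> Pat w0 w1.
have [i0 _] : exists i0 : I, true.
  apply: contrapT => nI; move: w1; rewrite big1 => [/esym/eqP|i _].
    by rewrite oner_eq0.
  by exfalso; apply: nI; exists i.
have key (s : seq I) (A : set T) : uniq s -> measurable A ->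
    pr P A = \sum_(i <- s) w i ->
  exists Y : T -> I, forall i, measurable (A `&` Y @^-1` [set i]) /\
    pr P (A `&` Y @^-1` [set i]) = if i \in s then w i else 0.
  elim: s A => [|i s IH] A /=.
    move=> _ mA; rewrite big_nil => PA; exists (fun=> i0) => i.
    have mi : measurable (A `&` (fun=> i0) @^-1` [set i]).
      by apply: measurableI => //; rewrite preimage_cst; case: ifP.
    have := pr_le P mi mA (@subIsetl _ _ _); rewrite PA => Pi0.
    by split => //; apply/eqP; rewrite ?in_nil eq_le Pi0 pr_ge0.
  move=> /andP[si us] mA; rewrite big_cons => PA.
  have [|B [mB BA PB]] := @atomless_intermediate_value _ _ _ P A (w i) Pat mA.
    by rewrite w0 PA lerDl sumr_ge0.
  have mAB : measurable (A `\` B) by exact: measurableD.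
  have [|Y YP] := IH _ us mAB; first by rewrite pr_setD // PA PB addrC addKr.
  exists (fun x => if x \in B then i else Y x) => j.
  have -> : A `&` (fun x => if x \in B then i else Y x) @^-1` [set j] =
      (B `&` [set _ | i = j]) `|` ((A `\` B) `&` Y @^-1` [set j]).
    apply/seteqP; split => x /=.
      by case: ifPn => [/set_mem Bx [_ ->]|/negP Bx [Ax Yx]]; [left|right];
        split => //; split => // /mem_set.
    move=> [[Bx ij]|[[Ax Bx] Yx]]; first by rewrite mem_set //; split => //; exact: BA.
    by rewrite memNset.
  have [mj Pj] := YP j; rewrite in_cons eq_sym.
  have [ij|ij] := eqVneq i j.
    have -> : [set _ : T | i = j] = setT by apply/seteqP; split.
    rewrite setIT; split; first exact: measurableU.
    rewrite pr_setU // ?Pj -?ij ?(negPf si) ?addr0 //.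
    by apply/seteqP; split => x // -[Bx [[_ /(_ Bx)]]].
  have -> : [set _ : T | i = j] = set0.
    by apply/seteqP; split => // x /= ijE; move: ij; rewrite ijE eqxx.
  by rewrite setI0 set0U.
have [|Y YP] := key _ setT (enum_uniq I) measurableT.
  by rewrite /pr probability_setT /= big_enum.
exists Y => i; have := YP i; rewrite setTI mem_enum.
exact.
Qed.

Lemma uniform_prob_ray (R : realType) (t : R) :
  uniform_prob (@ltr01 R) `]-oo, t]%classic = (Num.max 0 (Num.min t 1))%:E.
Proof.
rewrite /uniform_prob integral_uniform_pdf.
have [t0|t0] := ltP t 0.
  rewrite (_ : _ `&` _ = set0) ?integral_set0.
    by rewrite min_l ?max_l ?(ltW t0) // (le_trans (ltW t0)).
  apply/seteqP; split => x //=; rewrite !in_itv /= => -[xt /andP[x0 _]].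
  by move: t0; rewrite ltNge (le_trans x0 xt).
have m0 : 0 <= Num.min t 1 by rewrite le_min t0 ler01.
rewrite (_ : _ `&` _ = `[0, Num.min t 1]%classic); last first.
  apply/seteqP; split => x /=; rewrite !in_itv /= le_min.
    by move=> [-> /andP[-> ->]].
  by move=> /and3P[-> -> ->].
rewrite (eq_integral (cst 1%E)); last first.
  move=> x; rewrite inE /= in_itv /= le_min => /and3P[x0 _ x1].
  by rewrite /uniform_pdf x0 x1 subr0 invr1.
rewrite integral_cst //= lebesgue_measure_itv /= lte_fin mul1e sube0 max_r //.
by have [//|h] := ltP 0 (Num.min t 1); congr EFin; apply/eqP; rewrite eq_le m0 h.
Qed.

Lemma uniform01_cdf (R : realType) (d : measure_display) (T : measurableType d)
    (P : probability T R) (U : {RV P >-> R}) (t : R) :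
  uniform01 U -> 0 <= t <= 1 -> pr P [set x | U x <= t] = t.
Proof.
move=> [_ Ulaw] /andP[t0 t1]; apply: EFin_inj.
rewrite -prE; last exact: measurable_sublevel.
have := Ulaw `]-oo, t]%classic (measurable_itv _).
by rewrite uniform_prob_ray min_l // max_r // => <-.
Qed.

(** Two probabilities on the line that agree on half-open intervals are
    equal. *)
Lemma uniform01_of_cdf (R : realType) (d : measure_display) (T : measurableType d)
    (P : probability T R) (U : {RV P >-> R}) :
    (forall x, 0 <= U x <= 1) ->
    (forall t, 0 <= t <= 1 -> pr P [set x | U x <= t] = t) ->
  uniform01 U.
Proof.
move=> U01 Ut; split => // A mA.
have mfU : @measurable_fun _ _ T (measurableTypeR R) setT U by exact: (measurable_funPT U).
pose V : {mfun T >-> measurableTypeR R} :=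
  @mfun_Sub _ _ T (measurableTypeR R) U (mem_set mfU).
pose F t : R := Num.max 0 (Num.min t 1).
have mU t : measurable [set x | U x <= t] by exact: measurable_sublevel.
have cdfU t : distribution P V `]-oo, t]%classic = (F t)%:E.
  have -> : distribution P V `]-oo, t]%classic = P [set x | U x <= t].
    by rewrite /distribution /pushforward; congr (P _); apply/seteqP; split => x /=; rewrite in_itv.
  rewrite prE //; congr EFin; rewrite /F.
  have [t0|t0] := ltP t 0.
    rewrite min_l; last by rewrite (le_trans (ltW t0)).
    rewrite max_l ?ltW // (_ : [set _ | _] = set0) ?pr_set0 //.
    apply/seteqP; split => x //= xt; have /andP[+ _] := U01 x.
    by move=> U0; move: t0; rewrite ltNge (le_trans U0 xt).
  have [t1|t1] := leP t 1; first by rewrite max_r // Ut // t0.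
  rewrite max_r ?ler01 // (_ : [set _ | _] = setT); first by rewrite /pr probability_setT.
  by apply/seteqP; split => x //= _; have /andP[_ /le_trans] := U01 x; apply; exact: ltW.
have ocE (m : probability (measurableTypeR R) R) :
    (forall t, m `]-oo, t]%classic = (F t)%:E) ->
    forall a b, a < b -> m `]a, b]%classic = (F b - F a)%:E.
  move=> mF a b ab.
  pose Ha : set (measurableTypeR R) := `]-oo, a]%classic.
  pose Hb : set (measurableTypeR R) := `]-oo, b]%classic.
  have -> : `]a, b]%classic = Hb `\` Ha.
    apply/seteqP; split => x /=; rewrite /Hb /Ha /= !in_itv /=.
      by move=> /andP[ax xb]; split => //; apply/negP; rewrite -ltNge.
    by move=> [xb /negP]; rewrite -ltNge => ->.
  have Hba : Hb `&` Ha = Ha.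
    by rewrite setIidr // => x; rewrite /Hb /Ha /= !in_itv /= => /le_trans; apply; exact: ltW.
  have [mHa mHb] : measurable Ha /\ measurable Hb by split; exact: measurable_itv.
  have mHb_fin : (m Hb < +oo)%E by rewrite (mF b) ltry.
  have mD := @measureD _ _ _ m Hb Ha mHb mHa mHb_fin.
  rewrite mD Hba EFinB; congr (_ - _)%E; exact: mF.
pose g (k : nat) : set (measurableTypeR R) := `](- k%:R), k%:R]%classic.
have g_oc k : ocitv (g k) by exact: is_ocitv.
have gT : \bigcup_k g k = setT by exact: (bigcup_itvT false false).
have m12 (B : set (measurableTypeR R)) : ocitv B ->
    distribution P V B = uniform_prob (@ltr01 R) B.
  move=> /ocitvP[->|[[a b] /= ab ->]]; first by rewrite !measure0.
  by rewrite (ocE (distribution P V)) // (ocE (uniform_prob (@ltr01 R))) // => t;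
    exact: uniform_prob_ray.
have m1_fin k : (distribution P V (g k) < +oo)%E.
  by rewrite -ge0_fin_numE // fin_num_measure //; exact: measurable_itv.
exact: (@measure_unique _ R (measurableTypeR R) (@ocitv R) g erefl (@ocitvI R) g_oc gT
  (distribution P V) (uniform_prob (@ltr01 R)) m12 m1_fin A mA).
Qed.

(** Put the classes of Y one after the other on [0, 1], each occupying an
    interval of the length of its probability, and spread each class over its
    interval by [atomless_uniform_on]. *)
Lemma atomless_uniform_refining (R : realType) (d : measure_display)
    (T : measurableType d) (P : probability T R) (m : nat) (Y : T -> 'I_m) :
    atomless P -> (forall k, measurable (Y @^-1` [set k])) ->
  exists U : {RV P >-> R}, uniform01 U /\
    forall x, U x <= \sum_(k < m | (k <= Y x)%N) pr P (Y @^-1` [set k]).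
Proof.
move=> Pat mY.
have [h hP] := choice (fun k => atomless_uniform_on Pat (mY k)).
pose p k := pr P (Y @^-1` [set k]).
pose s (j : nat) := \sum_(k < m | (k < j)%N) p k.
have sS (k : 'I_m) : s k.+1 = s k + p k.
  rewrite /s (bigD1 k) //= addrC; congr (_ + _); apply: eq_bigl => i.
  by rewrite ltnS [RHS]ltn_neqAle andbC.
have p0 k : 0 <= p k by exact: pr_ge0.
have s_ge0 j : 0 <= s j by rewrite sumr_ge0.
have sm : s m = 1.
  have := pr_partition P measurableT mY; rewrite {1}/pr probability_setT /= => ->.
  by apply: eq_big => [k|k _]; rewrite ?ltn_ord ?setTI.
have s_le1 j : s j <= 1.
  rewrite -sm /s [leRHS](bigID (fun k : 'I_m => (k < j)%N)) /=.
  rewrite (eq_bigl (fun k : 'I_m => (k < m)%N && (k < j)%N)) => [|k]; last by rewrite ltn_ord.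
  by rewrite lerDl sumr_ge0.
pose U x := s (Y x) + h (Y x) x.
have h01 k x : 0 <= h k x <= p k by have [_ + _] := hP k; apply.
have mh k : measurable_fun setT (h k) by have [] := hP k.
have mhlt k t : measurable (Y @^-1` [set k] `&` [set x | h k x < t]).
  by apply: measurableI; [exact: mY|exact: measurable_strict_sublevel].
have mU : measurable_fun setT U.
  apply: measurable_fun_of_lt => t.
  have -> : [set x | U x < t] =
      \bigcup_(k in [set: 'I_m]) (Y @^-1` [set k] `&` [set x | h k x < t - s k]).
    apply/seteqP; split => x /=; rewrite /U.
      by exists (Y x) => //; split => //=; rewrite ltrBrDl.
    by move=> [k _ [/= ->]]; rewrite ltrBrDl.
  by apply: fin_bigcup_measurable => // k _; exact: mhlt.
pose V : {RV P >-> R} := mfun_Sub (mem_set mU).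
have U_le x : U x <= \sum_(k < m | (k <= Y x)%N) p k.
  have -> : \sum_(k < m | (k <= Y x)%N) p k = s (Y x).+1 by apply: eq_bigl => k.
  by rewrite sS lerD2l; have /andP[] := h01 (Y x) x.
exists V; split => //; apply: uniform01_of_cdf => [x|t /andP[t0 t1]].
  rewrite /= addr_ge0 //=; last by have /andP[] := h01 (Y x) x.
  apply: le_trans (U_le x) _; apply: le_trans (s_le1 (Y x).+1).
  by rewrite le_eqVlt; apply/orP; left; apply/eqP; apply: eq_bigl => k.
rewrite (pr_partition P _ mY); last exact: measurable_sublevel.
have cell (k : 'I_m) : pr P ([set x | V x <= t] `&` Y @^-1` [set k]) =
    Num.min t (s k.+1) - Num.min t (s k).
  have -> : [set x | V x <= t] `&` Y @^-1` [set k] =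
      Y @^-1` [set k] `&` [set x | h k x <= t - s k].
    apply/seteqP; split => x /=; rewrite /U.
      by move=> [+ Yx]; rewrite Yx lerBrDl.
    by move=> [Yx]; rewrite lerBrDl Yx.
  rewrite sS; have [_ _ hk] := hP k.
  have [ts|ts] := ltP t (s k).
    rewrite min_l ?subrr; last by rewrite (le_trans (ltW ts)) // lerDl.
    rewrite (_ : _ `&` _ = set0) ?pr_set0 //; apply/seteqP; split => x //= [_].
    have /andP[h0 _] := h01 k x; move=> /(le_trans h0).
    by rewrite subr_ge0 leNgt ts.
  have [tp|tp] := leP t (s k + p k).
    by rewrite hk // subr_ge0 ts lerBlDl.
  have -> : s k + p k - s k = p k by ring.
  congr (pr P _).
  apply/seteqP; split => [x []//|x /= Yx]; split => //=.
  have /andP[_ /le_trans] := h01 k x; apply.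
  by rewrite lerBrDl ltW.
rewrite (eq_bigr _ (fun k _ => cell k)).
rewrite -(big_mkord xpredT (fun k => Num.min t (s k.+1) - Num.min t (s k))).
rewrite telescope_sumr // sm min_l //.
by rewrite /s big_pred0 // min_r // subr0.
Qed.

(** * Cells with equally spaced powers *)

(** Convexity of the power function, in the form of Young's inequality for the
    exponents b and b / (b - 1). *)
Lemma powR_tangent (R : realType) (b y z : R) : 1 <= b -> 0 <= y -> 0 <= z ->
  y `^ b + b * y `^ (b - 1) * (z - y) <= z `^ b.
Proof.
rewrite le_eqVlt => /orP[/eqP <-|b1] y0 z0.
  by rewrite !powRr1 // subrr powRr0; lra.
have b0 : 0 < b by exact: lt_trans b1.
have s0 : 0 < b - 1 by rewrite subr_gt0.
have := @conjugate_powR _ z (y `^ (b - 1)) b (b / (b - 1)) z0 (powR_ge0 _ _) b0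
  (divr_gt0 b0 s0).
rewrite -powRrM (_ : (b - 1) * (b / (b - 1)) = b); last by field; rewrite gt_eqF.
have -> : b^-1 + (b / (b - 1))^-1 = 1.
  by field; rewrite gt_eqF //= gt_eqF.
move=> /(_ erefl); rewrite -(mulr_powRB1 y0 b0).
set t := y `^ (b - 1); set zb := z `^ b.
have -> : zb / b + y * t / (b / (b - 1)) = (zb + (b - 1) * (y * t)) / b.
  by field; rewrite gt_eqF //= gt_eqF.
by rewrite ler_pdivlMr //; nra.
Qed.

(** End points of N cells of [0, 1], spaced so that their rho-th powers divide
    [0, 1] evenly. *)
Definition cell_bound (R : realType) (rho : R) (N x : nat) : R :=
  (x%:R / N%:R) `^ rho^-1.

Lemma cell_bound0 (R : realType) (rho : R) N : 1 <= rho -> cell_bound rho N 0 = 0.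
Proof.
move=> r1; rewrite /cell_bound mul0r powR0 // invr_neq0 //.
by rewrite gt_eqF // (lt_le_trans ltr01).
Qed.

Lemma cell_bound_last (R : realType) (rho : R) N : (0 < N)%N -> cell_bound rho N N = 1.
Proof. by move=> N0; rewrite /cell_bound divff ?powR1 // pnatr_eq0 -lt0n. Qed.

Lemma cell_bound_powR (R : realType) (rho : R) N x : 1 <= rho ->
  cell_bound rho N x `^ rho = x%:R / N%:R.
Proof.
move=> r1; rewrite /cell_bound -powRrM mulVf ?powRr1 ?divr_ge0 //.
by rewrite gt_eqF // (lt_le_trans ltr01).
Qed.

Lemma cell_bound_le (R : realType) (rho : R) N x y : 1 <= rho -> (x <= y)%N ->
  cell_bound rho N x <= cell_bound rho N y.
Proof.
move=> r1 xy; rewrite /cell_bound ge0_ler_powR ?nnegrE ?divr_ge0 //.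
- by rewrite invr_ge0 (le_trans ler01).
- by rewrite ler_wpM2r ?invr_ge0 ?ler_nat.
Qed.

(** The rho-th powers of the three points are equally spaced, and the power
    function lies above its tangent at the middle one. *)
Lemma cell_bound_concave (R : realType) (rho : R) N x : 1 <= rho -> (0 < N)%N ->
  cell_bound rho N x.+2 - cell_bound rho N x.+1 <=
  cell_bound rho N x.+1 - cell_bound rho N x.
Proof.
move=> r1 N0.
have N0' : 0 < N%:R :> R by rewrite ltr0n.
have v0 : 0 < cell_bound rho N x.+1 by rewrite powR_gt0 // divr_gt0 ?ltr0n.
have rho0 : 0 < rho by rewrite (lt_le_trans ltr01).
have ge0 y : 0 <= cell_bound rho N y by exact: powR_ge0.
have := powR_tangent r1 (ltW v0) (ge0 x.+2).
have := powR_tangent r1 (ltW v0) (ge0 x).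
rewrite !cell_bound_powR //.
set t := rho * _; have t0 : 0 < t by rewrite mulr_gt0 // powR_gt0.
have -> : x.+2%:R / N%:R = x.+1%:R / N%:R + N%:R^-1 :> R by rewrite -[x.+2%:R]natr1; field; rewrite gt_eqF.
have -> : x.+1%:R / N%:R = x%:R / N%:R + N%:R^-1 :> R by rewrite -[x.+1%:R]natr1; field; rewrite gt_eqF.
set w := cell_bound rho N x; set v := cell_bound rho N x.+1; set u := cell_bound _ _ _.
move=> h1 h2; have : t * (u + w - 2 * v) <= 0 by lra.
by rewrite pmulr_rle0 //; lra.
Qed.

(** A lower Riemann sum of N * y^rho on [0, 1]: each term is compared with the
    increment of y^(rho + 1) by a tangent inequality, and the increments
    telescope. *)
Lemma cell_bound_mean (R : realType) (rho : R) N : 1 <= rho -> (0 < N)%N ->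
  \sum_(x < N) (cell_bound rho N x.+1 - cell_bound rho N x) * x%:R <=
    N%:R / (rho + 1).
Proof.
move=> r1 N0; pose g := cell_bound rho N.
have N0' : 0 < N%:R :> R by rewrite ltr0n.
have ge0 y : 0 <= g y by exact: powR_ge0.
have r11 : 1 <= rho + 1 by rewrite lerDr (le_trans ler01).
have r0 : 0 < rho + 1 by rewrite (lt_le_trans ltr01).
apply: (@le_trans _ _ (\sum_(x < N) (N%:R / (rho + 1)) *
    (g x.+1 `^ (rho + 1) - g x `^ (rho + 1)))).
  apply: ler_sum => x _.
  have := powR_tangent r11 (ge0 x) (ge0 x.+1).
  rewrite addrK cell_bound_powR // -/g => h.
  rewrite mulrAC ler_pdivlMr //.
  have := ler_wpM2l (ltW N0') h; set A := _ `^ _; set B := _ `^ _.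
  have -> : N%:R * (A + (rho + 1) * (x%:R / N%:R) * (g x.+1 - g x)) =
     N%:R * A + (g x.+1 - g x) * x%:R * (rho + 1) by field; rewrite gt_eqF.
  by rewrite mulrBr lerBrDl.
rewrite -mulr_sumr.
rewrite -(big_mkord xpredT (fun x => g x.+1 `^ (rho + 1) - g x `^ (rho + 1))).
rewrite telescope_sumr // /g cell_bound_last // cell_bound0 // powR1 powR0 ?subr0 ?mulr1 //.
by rewrite gt_eqF.
Qed.

(** * The coupling *)

Lemma pr_comp_preimage (R : realType) (d : measure_display) (T : measurableType d)
    (P : probability T R) (I J : finType) (Y : T -> I) (f : I -> J) (j : J) :
    (forall i, measurable (Y @^-1` [set i])) ->
  measurable ((f \o Y) @^-1` [set j]) /\
  pr P ((f \o Y) @^-1` [set j]) = \sum_(i | f i == j) pr P (Y @^-1` [set i]).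
Proof.
move=> mY.
have mfY : measurable ((f \o Y) @^-1` [set j]).
  rewrite (_ : _ @^-1` _ = \bigcup_(i in [set i | f i = j]) Y @^-1` [set i]).
    by apply: fin_bigcup_measurable.
  apply/seteqP; split => x /=; first by exists (Y x).
  by move=> [i /= <- ->].
split => //; rewrite (pr_partition P mfY mY) [RHS]big_mkcond; apply: eq_bigr => i _.
case: eqP => [<-|fij].
  by congr (pr P _); apply/seteqP; split => x /= [] // -> .
rewrite (_ : _ `&` _ = set0) ?pr_set0 //.
by apply/seteqP; split => x //= -[fY Yi]; apply: fij; rewrite -fY /= Yi.
Qed.

(** With probability a, draw a tuple t from the mixing weights of the cell law;
    otherwise draw nothing.  The i-th level is t i, or a level above
    all cells when nothing is drawn, and U_i refines the i-th level.  Since level x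
    has probability a times the length of cell x, U_i is below a times the upper
    end of the cell t i, and the budget on the t i bounds the power sum. *)
Lemma coupling_power_sum (R : realType) (d : measure_display) (T : measurableType d)
    (P : probability T R) (K N : nat) (rho a : R) :
    atomless P -> (0 < K)%N -> (0 < N)%N -> 1 <= rho -> rho + 1 <= K%:R -> 0 <= a <= 1 ->
  exists (U : 'I_K -> {RV P >-> R}) (E : set T),
    [/\ forall i, uniform01 (U i), measurable E, pr P E = a &
        forall x r, E x -> rho <= r ->
          \sum_i U i x `^ r <= a `^ r * (K%:R / (rho + 1) + (K%:R + 1) / N%:R)].
Proof.
case: N => // n Pat K0 N0 r1 rK /andP[a0 a1]; pose N := n.+1.
have rho0 : 0 < rho + 1 by rewrite ltr_wpDl // (le_trans ler01).
pose p x := cell_bound rho N x.+1 - cell_bound rho N x.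
(* The least integer above K times the bound N / (rho + 1) on the mean index. *)
pose c := (Num.trunc (K%:R * N%:R / (rho + 1))).+1.
have c_gt : K%:R * N%:R / (rho + 1) < c%:R by exact: truncnS_gt.
have c_le : c%:R <= K%:R * N%:R / (rho + 1) + 1.
  rewrite /c -natr1 lerD2r; apply: (proj1 (andP (truncn_itv _))).
  by rewrite divr_ge0 ?mulr_ge0 // ltW.
have nc : (n <= c)%N.
  rewrite -(ler_nat R); apply: le_trans (ltW c_gt).
  have -> : K%:R * N%:R / (rho + 1) = N%:R * (K%:R / (rho + 1)) by ring.
  apply: (@le_trans _ _ N%:R); first by rewrite ler_nat.
  by rewrite ler_peMr // ler_pdivlMr // mul1r.
have p1 : \sum_(x < n.+1) p x = 1.
  rewrite -(big_mkord xpredT p) telescope_sumr // -/N cell_bound_last // cell_bound0 //.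
  by rewrite subr0.
have p0 x : 0 <= p x by rewrite subr_ge0 cell_bound_le.
have pdec x : (x < n)%N -> p x.+1 <= p x by move=> _; exact: cell_bound_concave.
have pmean : K%:R * \sum_(x < n.+1) p x * x%:R <= c%:R.
  apply: le_trans (ltW c_gt); rewrite -mulrA ler_wpM2l //.
  exact: cell_bound_mean.
have [w [w0 wc w1 wp]] := mixing_coordinates K0 nc p1 p0 pdec pmean.
pose I : finType := ({ffun 'I_K -> 'I_n.+1} + unit)%type.
pose wt (i : I) := match i with inl t => a * w t | inr _ => 1 - a end.
have wt0 i : 0 <= wt i by case: i => [t|_] /=; rewrite ?mulr_ge0 // subr_ge0.
have wt1 : \sum_i wt i = 1.
  rewrite big_sumType /= -mulr_sumr w1 (big_pred1 tt) /=; last by case.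
  by rewrite mulr1 addrC subrK.
have [Y YP] := atomless_discrete_law Pat wt0 wt1.
have mY i : measurable (Y @^-1` [set i]) by have [] := YP i.
have PY i : pr P (Y @^-1` [set i]) = wt i by have [] := YP i.
(* The extra level N collects the complement of the event. *)
pose lev (i : 'I_K) (y : I) : 'I_N.+1 :=
  match y with inl t => widen_ord (leqnSn N) (t i) | inr _ => ord_max end.
have mlev i k : measurable ((lev i \o Y) @^-1` [set k]).
  by have [] := pr_comp_preimage P (lev i) k mY.
have Plev i (k : 'I_n.+1) :
    pr P ((lev i \o Y) @^-1` [set widen_ord (leqnSn N) k]) = a * p k.
  have [_ ->] := pr_comp_preimage P (lev i) (widen_ord (leqnSn N) k) mY.
  under eq_bigr do rewrite PY.
  rewrite big_sumType /= [X in _ + X]big_pred0 ?addr0; last first.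
    by move=> _; apply/negbTE; rewrite -val_eqE /= eq_sym neq_ltn ltn_ord.
  by rewrite -(wp i) mulr_sumr; apply: eq_bigl => t; rewrite -val_eqE.
have [U UP] := choice (fun i => atomless_uniform_refining Pat (mlev i)).
pose good (y : I) := if y is inl t then (\sum_i t i <= c)%N else false.
have [mE PE] := pr_comp_preimage P good true mY.
exists U, ((good \o Y) @^-1` [set true]); split.
- by move=> i; have [] := UP i.
- exact: mE.
- rewrite PE; under eq_bigr do rewrite PY.
  rewrite big_sumType /= [X in _ + X]big_pred0 ?addr0 // -mulr_sumr.
  rewrite -[RHS]mulr1 -w1; congr (_ * _); rewrite [RHS](bigID (fun t => good (inl t) == true)) /=.
  rewrite [X in _ + X]big1 ?addr0 // => t; rewrite eqb_id => nt.
  by apply/eqP; apply: contraNT nt => /wc.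
move=> x r; rewrite /= /good; case Yx: (Y x) => [t|] // tc rr.
have Ui i : U i x <= a * cell_bound rho N (t i).+1.
  have [_ /(_ x)] := UP i => /le_trans; apply.
  have -> : (lev i \o Y) x = widen_ord (leqnSn N) (t i) by rewrite /= Yx.
  rewrite big_mkcond big_ord_recr /= leqNgt ltn_ord /= addr0.
  rewrite -big_mkcond (eq_bigr (fun k : 'I_n.+1 => a * p k)); last by move=> k _; exact: Plev.
  rewrite -mulr_sumr ler_wpM2l //.
  have <- : \sum_(0 <= k < (t i).+1) p k = cell_bound rho N (t i).+1.
    by rewrite telescope_sumr // cell_bound0 // subr0.
  by rewrite big_mkord (big_ord_widen N p).
apply: (@le_trans _ _ (\sum_i a `^ r * ((t i).+1%:R / N%:R))).
  apply: ler_sum => i _.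
  have cb_gt0 : 0 < cell_bound rho N (t i).+1 by rewrite powR_gt0 // divr_gt0 ?ltr0n.
  have cb_le1 : cell_bound rho N (t i).+1 <= 1.
    by rewrite -(cell_bound_last rho N0) cell_bound_le.
  have U0 : 0 <= U i x by have [[/(_ x)/andP[]]] := UP i.
  have r0 : 0 <= r by rewrite (le_trans _ rr) // (le_trans ler01).
  apply: (@le_trans _ _ ((a * cell_bound rho N (t i).+1) `^ r)).
    by rewrite ge0_ler_powR ?nnegrE // mulr_ge0 // ltW.
  rewrite powRM // ?(ltW cb_gt0) // ler_wpM2l ?powR_ge0 //.
  by rewrite -(cell_bound_powR N _ r1) ger_powR // cb_gt0.
rewrite -mulr_sumr ler_wpM2l ?powR_ge0 // -mulr_suml.
have -> : \sum_i (t i).+1%:R = (\sum_i t i)%:R + K%:R :> R.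
  rewrite (eq_bigr (fun i => (t i)%:R + 1)) => [|i _]; last by rewrite natr1.
  by rewrite big_split /= sumr_const card_ord natr_sum.
have -> : K%:R / (rho + 1) + (K%:R + 1) / N%:R =
    (K%:R * N%:R / (rho + 1) + 1 + K%:R) / N%:R :> R.
  by field; rewrite pnatr_eq0 (gt_eqF rho0).
rewrite ler_wpM2r ?invr_ge0 // lerD2r; apply: le_trans c_le.
by rewrite ler_nat.
Qed.

(** * The upper bound *)

(** Markov's inequality for the number of the B j that occur. *)
Lemma counting_bound (R : realType) (d : measure_display) (T : measurableType d)
    (P : probability T R) (J : finType) (B : J -> set T) (A : set T) (m : R) :
    0 <= m -> measurable A -> (forall j, measurable (B j)) ->
    (forall x, A x -> m <= \sum_j (x \in B j)%:R) ->
  m * pr P A <= \sum_j pr P (B j).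
Proof.
move=> m0 mA mB AB; rewrite -lee_fin EFinM -prE //.
have -> : (\sum_j pr P (B j))%:E = (\sum_j P (B j))%E.
  by rewrite -sumEFin; apply: eq_bigr => j _; rewrite prE.
have -> : (m%:E * P A = \int[P]_x (m * \1_A x)%:E)%E.
  under eq_integral do rewrite EFinM.
  by rewrite ge0_integralZl_EFin ?integral_indic ?setIT //; exact/measurable_EFinP/measurable_indic.
have -> : (\sum_j P (B j) = \int[P]_x (\sum_j (\1_(B j) x)%:E))%E.
  rewrite ge0_integral_sum //; last by move=> j; exact/measurable_EFinP/measurable_indic.
  by apply: eq_bigr => j _; rewrite integral_indic ?setIT.
apply: ge0_le_integral => //.
- by move=> x _; rewrite lee_fin mulr_ge0.
- under eq_fun do rewrite EFinM.
  by apply: measurable_funeM; exact/measurable_EFinP/measurable_indic.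
- by apply: emeasurable_sum => j; exact/measurable_EFinP/measurable_indic.
- move=> x _; rewrite sumEFin lee_fin indicE.
  have [/set_mem Ax|_] := boolP (x \in A); last by rewrite mulr0 sumr_ge0.
  rewrite mulr1; apply: le_trans (AB x Ax) _.
  by apply: ler_sum => j _; rewrite indicE.
Qed.

(** An upper Riemann sum of N * y^(1/rho), whose integral is
    N * rho / (rho + 1).  Summation by parts turns it into the upper Riemann sum of
    the inverse function, to which tangent inequalities apply. *)
Lemma cell_bound_sum_le (R : realType) (rho : R) N : 1 <= rho -> (0 < N)%N ->
  \sum_(x < N) cell_bound rho N x.+1 <= N%:R * (rho / (rho + 1)) + 1.
Proof.
move=> r1 N0; pose g := cell_bound rho N.
have N0' : 0 < N%:R :> R by rewrite ltr0n.
have ge0 y : 0 <= g y by exact: powR_ge0.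
have r11 : 1 <= rho + 1 by rewrite lerDr (le_trans ler01).
have r0 : 0 < rho + 1 by rewrite (lt_le_trans ltr01).
have step (x : nat) : (N%:R / (rho + 1)) * (g x.+1 `^ (rho + 1) - g x `^ (rho + 1)) <=
    (g x.+1 - g x) * x.+1%:R.
  have := powR_tangent r11 (ge0 x.+1) (ge0 x).
  rewrite addrK cell_bound_powR // -/g => h.
  rewrite mulrAC ler_pdivrMr //.
  have := ler_wpM2l (ltW N0') h; set A := _ `^ _; set B := _ `^ _.
  have -> : N%:R * (A + (rho + 1) * (x.+1%:R / N%:R) * (g x - g x.+1)) =
     N%:R * A - (g x.+1 - g x) * x.+1%:R * (rho + 1) by field; rewrite gt_eqF.
  by rewrite mulrBr lerBlDr lerBlDr addrC.
have : \sum_(x < N) (N%:R / (rho + 1)) * (g x.+1 `^ (rho + 1) - g x `^ (rho + 1)) <=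
    \sum_(x < N) (g x.+1 - g x) * x.+1%:R by apply: ler_sum => x _; exact: step.
rewrite -mulr_sumr.
rewrite -(big_mkord xpredT (fun x => g x.+1 `^ (rho + 1) - g x `^ (rho + 1))).
rewrite telescope_sumr // /g cell_bound_last // cell_bound0 // powR1 powR0 ?subr0 ?mulr1;
  last by rewrite gt_eqF.
rewrite -/g => le1.
have parts : \sum_(x < N) (g x.+1 - g x) * x.+1%:R = N%:R - \sum_(x < N) g x.
  have : \sum_(0 <= x < N) (g x.+1 * x.+1%:R - g x * x%:R) = N%:R.
    by rewrite telescope_sumr // /g cell_bound_last // mul1r mulr0 subr0.
  rewrite big_mkord => <-; rewrite -sumrB; apply: eq_bigr => x _.
  by rewrite -[x.+1%:R]natr1; ring.
have -> : \sum_(x < N) g x.+1 = \sum_(x < N) g x + 1.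
  have : \sum_(0 <= x < N) (g x.+1 - g x) = 1.
    by rewrite telescope_sumr // /g cell_bound_last // cell_bound0 // subr0.
  by rewrite big_mkord sumrB => /eqP; rewrite subr_eq addrC => /eqP.
rewrite lerD2r; move: le1; rewrite parts lerBrDr -lerBrDl => /le_trans; apply.
rewrite le_eqVlt; apply/orP; left; apply/eqP.
by field; rewrite gt_eqF.
Qed.

Lemma level_count (R : realDomainType) (N : nat) (t : R) : 0 <= t ->
  N%:R - t <= \sum_(k < N) ((t <= k.+1%:R)%R : nat)%:R.
Proof.
move=> t0; elim: N => [|N IH]; first by rewrite big_ord0 sub0r oppr_le0.
rewrite big_ord_recr /=; have [tN|tN] := leP t N.+1%:R.
  by rewrite -[N.+1%:R]natr1 addrAC lerD2r.
rewrite addr0 (@le_trans _ _ 0) ?sumr_ge0 // subr_le0; exact: ltW.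
Qed.

(** Count the pairs (i, k) with U_i at most eps times the upper end of the k-th of
    N cells.  On A there are at least N * K * r / (r + 1) of them, because U_i stays
    below about N * (1 - (U_i / eps)^r) thresholds; the expected number is at most
    eps * K * (N * r / (r + 1) + 1).  Then N tends to infinity. *)
Lemma power_sum_tail (R : realType) (d : measure_display) (T : measurableType d)
    (P : probability T R) (K : nat) (U : 'I_K -> {RV P >-> R}) (r eps : R) :
    (0 < K)%N -> 1 <= r -> (forall i, uniform01 (U i)) -> 0 < eps <= 1 ->
    let A := [set x | (r + 1) * \sum_i U i x `^ r <= K%:R * eps `^ r] in
  measurable A -> pr P A <= eps.
Proof.
move=> K0 r1 UU /andP[e0 e1] A mA.
have r0 : 0 < r by rewrite (lt_le_trans ltr01).
have r10 : 0 < r + 1 by rewrite ltr_wpDl // ltW.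
have K0' : 0 < K%:R :> R by rewrite ltr0n.
have U0 i x : 0 <= U i x by have [/(_ x)/andP[]] := UU i.
(* The constant 2 dominates (r + 1) / r. *)
have bound N : (0 < N)%N -> pr P A <= eps + 2 / N%:R.
  move=> N0; have N0' : 0 < N%:R :> R by rewrite ltr0n.
  pose g := cell_bound r N.
  pose B (j : 'I_K * 'I_N) := [set x | U j.1 x <= eps * g j.2.+1].
  have g01 (k : 'I_N) : 0 <= g k.+1 <= 1.
    by rewrite powR_ge0 /= -(cell_bound_last r N0) cell_bound_le.
  have mB j : measurable (B j) by exact: measurable_sublevel.
  have PB j : pr P (B j) = eps * g j.2.+1.
    have /andP[g0 g1] := g01 j.2; apply: uniform01_cdf => //.
    by rewrite mulr_ge0 ?(ltW e0) //= mulr_ile1 // ltW.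
  pose m := N%:R * (K%:R * (r / (r + 1))).
  have m0 : 0 <= m by rewrite !mulr_ge0 ?invr_ge0 // ltW.
  have cover x : A x -> m <= \sum_j (x \in B j)%:R.
    move=> Ax; pose v i := (U i x / eps) `^ r.
    have v0 i : 0 <= v i by exact: powR_ge0.
    have vE i : v i = U i x `^ r / eps `^ r.
      by rewrite /v powRM ?invr_ge0 ?(ltW e0) // -powR_inv1 ?(ltW e0) // powRAC powR_inv1 ?powR_ge0.
    have vsum : \sum_i v i <= K%:R / (r + 1).
      under eq_bigr do rewrite vE.
      rewrite -mulr_suml ler_pdivlMr // mulrAC ler_pdivrMr ?powR_gt0 //.
      by rewrite mulrC.
    have level i : N%:R - N%:R * v i <= \sum_(k < N) (x \in B (i, k))%:R.
      apply: le_trans (level_count N (mulr_ge0 (ltW N0') (v0 i))) _; apply: ler_sum => k _.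
      rewrite ler_nat; case: (leP (N%:R * v i) k.+1%:R) => // vk.
      rewrite mem_set // /B /= -ler_pdivrMl // mulrC.
      have -> : U i x / eps = v i `^ r^-1.
        by rewrite /v -powRrM divff ?powRr1 ?divr_ge0 ?(ltW e0) // gt_eqF.
      rewrite ge0_ler_powR ?nnegrE ?invr_ge0 ?(ltW r0) ?divr_ge0 //.
      by rewrite ler_pdivlMr // mulrC.
    rewrite -(pair_bigA _ (fun i k => (x \in B (i, k))%:R)) /=.
    apply: le_trans (ler_sum _ (fun i _ => level i)).
    rewrite sumrB sumr_const card_ord -mulr_sumr -[N%:R *+ K]mulr_natr -mulrBr ler_wpM2l //.
    have -> : K%:R * (r / (r + 1)) = K%:R - K%:R / (r + 1) by field; rewrite gt_eqF.
    by rewrite lerD2l lerN2.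
  have := counting_bound P m0 mA mB cover.
  rewrite (eq_bigr (fun j : 'I_K * 'I_N => eps * g j.2.+1)) => [|j _]; last exact: PB.
  rewrite -(pair_bigA _ (fun i (k : 'I_N) => eps * g k.+1)) /= sumr_const card_ord -mulr_sumr.
  move=> le_m.
  have := cell_bound_sum_le r1 N0; rewrite -/g; set S := \sum_(_ < _) _ in le_m *.
  move=> le_S.
  have m_gt0 : 0 < m by rewrite !mulr_gt0 ?invr_gt0.
  rewrite -(ler_pM2l m_gt0); apply: le_trans le_m _.
  rewrite -[_ *+ K]mulr_natr.
  apply: (@le_trans _ _ (eps * (N%:R * (r / (r + 1)) + 1) * K%:R)).
    by rewrite ler_wpM2r // ler_wpM2l // ltW.
  have -> : m * (eps + 2 / N%:R) = (eps * (N%:R * (r / (r + 1))) + 2 * (r / (r + 1))) * K%:R.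
    by rewrite /m; field; rewrite !gt_eqF.
  rewrite ler_wpM2r // mulrDr mulr1 lerD2l (le_trans e1) // mulrA ler_pdivlMr //.
  by lra.
apply/ler_addgt0Pr => e e_gt0.
have := bound (Num.trunc (2 / e)).+1 isT => /le_trans; apply.
rewrite lerD2l ler_pdivrMr // mulrC -ler_pdivrMr // ltW //.
exact: truncnS_gt.
Qed.

(** * The precise merging function *)

Lemma weighted_mean_le (R : realType) (c r S k eps : R) :
    0 <= c -> 0 < r -> 0 <= S -> 0 < k -> 0 <= eps ->
  (c `^ r^-1 * (S / k) `^ r^-1 <= eps) = (c * S <= k * eps `^ r).
Proof.
move=> c0 r0 S0 k0 e0; have Sk0 : 0 <= S / k by rewrite divr_ge0 // ltW.
rewrite -powRM //; have cS0 : 0 <= c * (S / k) by rewrite mulr_ge0.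
have inv (x : R) : 0 <= x -> (x `^ r^-1) `^ r = x.
  by move=> x0; rewrite -powRrM mulVf ?powRr1 // gt_eqF.
have inv' (x : R) : 0 <= x -> (x `^ r) `^ r^-1 = x.
  by move=> x0; rewrite -powRrM mulfV ?powRr1 // gt_eqF.
have -> : (c * S <= k * eps `^ r) = (c * (S / k) <= eps `^ r).
  by rewrite mulrA ler_pdivrMr // [_ * k]mulrC.
apply/idP/idP => h.
  by rewrite -(inv _ cS0) ge0_ler_powR ?nnegrE ?powR_ge0 // ltW.
by rewrite -(inv' _ e0) ge0_ler_powR ?nnegrE ?powR_ge0 ?invr_ge0 // ltW.
Qed.

Theorem proposition5 (R : realType) (d : measure_display)
    (T : measurableType d) (P : probability T R) (P_atomless : atomless P)
    (K : nat) (K_ge2 : (2 <= K)%N) (r : R) (r_ge1 : 1 <= r) :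
  precise_merging_function P
    (fun p : K.-tuple R =>
       Num.min (r + 1) K%:R `^ r^-1 * power_mean r p).
Proof.
have K0 : (0 < K)%N by exact: ltnW.
have K0' : 0 < K%:R :> R by rewrite ltr0n.
have K2 : 2 <= K%:R :> R by rewrite (ler_nat R 2).
have r0 : 0 < r by rewrite (lt_le_trans ltr01).
pose c : R := Num.min (r + 1) K%:R.
have c0 : 0 < c by rewrite /c lt_min K0' andbT ltr_wpDl // ltW.
pose F (p : K.-tuple R) := c `^ r^-1 * power_mean r p.
pose sum_pow (p : K.-tuple R) := \sum_(i < K) tnth p i `^ r.
have sum_pow_ge0 p : 0 <= sum_pow p by apply: sumr_ge0 => i _; exact: powR_ge0.
have FE p (eps : R) : 0 <= eps -> (F p <= eps) = (c * sum_pow p <= K%:R * eps `^ r).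
  by move=> e0; exact: weighted_mean_le (ltW c0) r0 (sum_pow_ge0 p) K0' e0.
pose tup (U : 'I_K -> {RV P >-> R}) (w : T) : K.-tuple R := [tuple (U i : T -> R) w | i < K].
have sum_powE U w : sum_pow (tup U w) = \sum_i U i w `^ r.
  by apply: eq_bigr => i _; rewrite tnth_mktuple.
have levelE U (eps : R) : 0 <= eps ->
    [set w | F (tup U w) <= eps] = [set w | c * \sum_i U i w `^ r <= K%:R * eps `^ r].
  by move=> e0; apply/seteqP; split => w /=; rewrite FE // sum_powE.
have mlevel (b s : R) (U : 'I_K -> {RV P >-> R}) :
    measurable [set w | b * \sum_i U i w `^ r <= s].
  apply: (@measurable_sublevel R _ T (fun w => b * \sum_i U i w `^ r)).
  apply: measurable_funM => //; apply: measurable_sum => i.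
  exact: (measurableT_comp (f := @powR R ^~ r) (measurable_powR r)).
have upper (eps : R) : 0 < eps < 1 -> (sup_prob_le P F eps <= eps%:E)%E.
  move=> /andP[e0 e1]; rewrite /sup_prob_le; apply: ge_ereal_sup => _ [U /= UU <-].
  rewrite -/(tup U) levelE ?(ltW e0) // prE // lee_fin.
  have [rK|Kr] := leP (r + 1) K%:R.
    rewrite /c min_l //; apply: power_sum_tail => //; by rewrite e0 ltW.
  rewrite /c min_r; last exact: ltW.
  pose i0 : 'I_K := Ordinal K0.
  rewrite -[leRHS](uniform01_cdf (UU i0)); last by rewrite (ltW e0) ltW.
  apply: pr_le; [exact: mlevel|exact: measurable_sublevel|].
  move=> w /=; rewrite ler_pM2l // (bigD1 i0) //= => h.
  have U0 : 0 <= U i0 w by have [/(_ w)/andP[]] := UU i0.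
  rewrite leNgt; apply/negP => lt_e; move: h; apply/negP; rewrite -ltNge.
  apply: (@lt_le_trans _ _ (U i0 w `^ r)); last by rewrite lerDl sumr_ge0 // => *; exact: powR_ge0.
  by apply: gt0_ltr_powR => //; rewrite nnegrE ltW.
have lower (eps : R) : 0 < eps < 1 -> (eps%:E <= sup_prob_le P F eps)%E.
  move=> /andP[e0 e1]; apply/lee_addgt0Pr => e e_gt0.
  (* The maximum matters only if e exceeds eps. *)
  pose a := Num.max 0 (eps - e).
  have a0 : 0 <= a by rewrite le_max lexx.
  have a_lt : a < eps by rewrite /a gt_max e0 /= ltrBlDr ltrDl.
  have ar_lt : a `^ r < eps `^ r by apply: gt0_ltr_powR => //; rewrite nnegrE // ltW.
  have gap : 0 < K%:R * (eps `^ r - a `^ r) by rewrite mulr_gt0 // subr_gt0.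
  (* N makes c * (K + 1) / N, the discretisation error, smaller than the gap. *)
  pose N := (Num.trunc (c * (K%:R + 1) / (K%:R * (eps `^ r - a `^ r)))).+1.
  (* The mixing condition n <= c of the cell law limits the exponent to K - 1. *)
  pose rho := Num.min r (K%:R - 1).
  have rho1 : 1 <= rho by rewrite /rho le_min r_ge1 /= lerBrDr.
  have rhoc : rho + 1 = c.
    by rewrite /rho /c addr_minl subrK.
  have rhoK : rho + 1 <= K%:R by rewrite rhoc /c ge_min lexx orbT.
  have a1 : a <= 1 by rewrite ltW // (lt_trans a_lt).
  have [|U [E [UU mE PE EU]]] :=
    @coupling_power_sum _ _ _ P K N rho a P_atomless K0 isT rho1 rhoK.
    by rewrite a0 a1.
  apply: (@le_trans _ _ (a%:E + e%:E)%E).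
    by rewrite -EFinD lee_fin -lerBlDr /a le_max lexx orbT.
  rewrite leeD2r // -PE -prE //.
  apply: (@le_trans _ _ (P [set w | F (tup U w) <= eps])); last first.
    by apply: ereal_sup_ubound; exists U.
  rewrite levelE ?(ltW e0) //; apply: le_measure; rewrite ?inE //.
  move=> w Ew /=; have := EU w r Ew; rewrite rhoc => /(_ _).
  have rr : rho <= r by rewrite /rho ge_min lexx.
  move=> /(_ rr) h; apply: (@le_trans _ _ (c * (a `^ r * (K%:R / c + (K%:R + 1) / N%:R)))).
    by rewrite ler_wpM2l // ltW.
  have N_gt : c * (K%:R + 1) / (K%:R * (eps `^ r - a `^ r)) < N%:R by exact: truncnS_gt.
  have ar1 : a `^ r <= 1.
    have <- : (1 : R) `^ r = 1 by rewrite powR1.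
    by rewrite ge0_ler_powR ?nnegrE // ltW.
  have -> : c * (a `^ r * (K%:R / c + (K%:R + 1) / N%:R)) =
      K%:R * a `^ r + a `^ r * (c * (K%:R + 1) / N%:R).
    by field; rewrite /N pnatr_eq0 /= gt_eqF.
  rewrite -lerBrDl -mulrBr.
  apply: (@le_trans _ _ (c * (K%:R + 1) / N%:R)).
    by rewrite ler_piMl // divr_ge0 // mulr_ge0 ?addr_ge0 // ltW.
  by rewrite ler_pdivrMr // [leRHS]mulrC -ler_pdivrMr // ltW.
split; first split.
- apply: measurable_funTS; rewrite /power_mean.
  apply: measurable_funM => //; apply: (measurableT_comp (f := @powR R ^~ r^-1)); first exact: measurable_powR.
  apply: measurable_funM => //; apply: measurable_sum => i.
  exact: (measurableT_comp (f := @powR R ^~ r) (measurable_powR r) (measurable_tnth i)).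
- by move=> p _; rewrite mulr_ge0 // powR_ge0.
- move=> i p q pc qc pq piq; apply: ler_wpM2l; first exact: powR_ge0.
  apply: ge0_ler_powR; rewrite ?nnegrE ?invr_ge0 ?(ltW r0) //.
  + by apply: divr_ge0; [exact: sum_pow_ge0|exact: ltW].
  + by apply: divr_ge0; [exact: sum_pow_ge0|exact: ltW].
  apply: ler_wpM2r; first by rewrite invr_ge0 ltW.
  apply: ler_sum => j _.
  have [->|ji] := eqVneq j i; last by rewrite (pq j ji).
  have /andP[p0 _] := pc i; have /andP[q0 _] := qc i.
  by apply: ge0_ler_powR; rewrite ?nnegrE // ltW.
- exact: upper.
- by move=> eps e01; apply/eqP; rewrite eq_le upper // lower.
Qed.
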